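(* Let $n\ge2$ and $N\ge1$ be integers. There exist constants $\lambda,\Lambda>0$, a coefficient matrix $A=(A_{ij}^{\alpha\beta})\in C(\bar B_4)$ satisfying $$|A(x)|\le \Lambda \quad\text{for a.e. } x\in B_4,$$ $$\int_{B_4} A_{ij}^{\alpha\beta}\,\partial_\beta\varphi^j\,\partial_\alpha\varphi^i\,dx\ \ge\ \lambda\,\|\nabla\varphi\|_{L^2(B_4)}^2\quad\text{for all }\varphi\in H_0^1(B_4),$$ and $$\limsup_{r\to0}\ r\int_r^2\frac{\omega_{A,2}(t)}{t^2}\exp\Big(C_*\int_t^2\frac{\omega_{A,2}(s)}{s}\,ds\Big)\,dt=0,$$ and a solution $u\in H^1(B_4)$ of $$\partial_\alpha(A_{ij}^{\alpha\beta}\partial_\beta u^j)=0\quad\text{in }B_4,\quad i=1,\dots,N,$$ such that $\nabla u\in VMO(B_4)$ but $\nabla u\notin L^\infty_{\rm loc}(B_2)$.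
   Context: $C_*=C_*(n,N,\Lambda,\lambda)>0$ is a given positive constant depending only on $n$, $N$, $\Lambda$ and $\lambda$. $B_r(x)$ is the ball in $\mathbb{R}^n$ with center $x$ and radius $r$, and $B_r=B_r(0)$. Functions $u=(u^1,\dots,u^N)$ and $\varphi=(\varphi^1,\dots,\varphi^N)$ are $\mathbb{R}^N$-valued. Repeated indices are summed, with $1\le\alpha,\beta\le n$ and $1\le i,j\le N$. Solutions are understood in the weak (distributional) sense. For $0<r\le2$, $(A)_{B_r(x)}=\frac{1}{|B_r(x)|}\int_{B_r(x)}A(y)\,dy$ and $$\omega_{A,2}(r)=\sup_{x\in B_2}\Big\{\frac{1}{|B_r(x)|}\int_{B_r(x)}|A(y)-(A)_{B_r(x)}|^2\,dy\Big\}^{1/2}.$$ $VMO$ denotes the usual space of functions of vanishing mean oscillation. *)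

(* Defs.v *)
From HB Require Import structures.
From mathcomp Require Import all_boot all_order all_algebra.
From mathcomp Require Import all_classical all_reals all_analysis.

Set Implicit Arguments.
Unset Strict Implicit.
Unset Printing Implicit Defensive.

Import Order.TTheory GRing.Theory Num.Theory.
Import numFieldNormedType.Exports.

Local Open Scope classical_set_scope.
Local Open Scope ring_scope.

(* R^n is 'rV[R]_n, with the sigma-algebra generated by the coordinates (the
   Borel sets), following the library's treatment of n.-tuple T. *)
Definition measure_rV_display : measure_display -> measure_display.
Proof. exact. Qed.

Section measurable_rV.
Context {d} {T : measurableType d} (n : nat).

Let coords : 'I_n -> 'rV[T]_n -> T := fun i x => x ord0 i.

Let rV_set0 : g_sigma_preimage coords set0.
Proof. exact: sigma_algebra0. Qed.

Let rV_setC A : g_sigma_preimage coords A -> g_sigma_preimage coords (~` A).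
Proof. exact: sigma_algebraC. Qed.

Let rV_bigcup (F : _^nat) : (forall i, g_sigma_preimage coords (F i)) ->
  g_sigma_preimage coords (\bigcup_i (F i)).
Proof. exact: sigma_algebra_bigcup. Qed.

HB.instance Definition _ := @isMeasurable.Build (measure_rV_display d)
  'rV[T]_n (g_sigma_preimage coords) rV_set0 rV_setC rV_bigcup.
End measurable_rV.

Section measurable_rV_theory.
Context {d} {T : measurableType d}.

Lemma measurable_coord n (i : 'I_n) :
  measurable_fun [set: 'rV[T]_n] (fun x => x ord0 i).
Proof.
move=> _ Y mY; rewrite setTI; apply: sub_sigma_algebra => /=.
rewrite -bigcup_seq/=; exists i => /=; first by rewrite mem_index_enum.
by exists Y => //; rewrite setTI.
Qed.

Lemma measurable_fun_rV d' (S : measurableType d') n (f : S -> 'rV[T]_n) :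
  (forall i, measurable_fun [set: S] (fun s => f s ord0 i)) ->
  measurable_fun [set: S] f.
Proof.
move=> mf; apply: measurability; first by [].
move=> _ [B + <-].
rewrite -bigcup_seq => -[i _ [C mC <-]].
rewrite setTI -[X in measurable X]setTI.
by have := mf i measurableT C mC; rewrite !setTI.
Qed.

End measurable_rV_theory.

Section lebesgue_rV.
Context {R : realType}.
Local Notation TR := (measurableTypeR R).

Definition rV_cons n (p : TR * 'rV[R]_n) : 'rV[R]_n.+1 :=
  \row_i oapp (p.2 ord0) p.1 (unlift ord0 i).

Lemma measurable_rV_cons n : measurable_fun setT (@rV_cons n).
Proof.
apply: measurable_fun_rV => i.
have [j ->|->] := unliftP ord0 i.
  rewrite (_ : (fun _ => _) = (fun x : 'rV[R]_n => x ord0 j) \o snd).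
    by apply: measurableT_comp => //; exact: measurable_coord.
  by apply/funext => p; rewrite mxE liftK.
rewrite (_ : (fun _ => _) = fst); first exact: measurable_fst.
by apply/funext => p; rewrite mxE unlift_none.
Qed.


Definition rV_uncons n (x : 'rV[R]_n.+1) : TR * 'rV[R]_n :=
  (x ord0 ord0, \row_j x ord0 (lift ord0 j)).

Lemma measurable_rV_uncons n : measurable_fun setT (@rV_uncons n).
Proof.
apply/measurable_fun_pairP; split; first exact: measurable_coord.
apply: measurable_fun_rV => i.
rewrite (_ : (fun _ => _) = (fun x : 'rV[R]_n.+1 => x ord0 (lift ord0 i))).
  exact: measurable_coord.
by apply/funext => p; rewrite mxE.
Qed.

Lemma rV_consK n : cancel (@rV_cons n) (@rV_uncons n).
Proof.
case=> a x; congr pair; first by rewrite mxE unlift_none.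
by apply/rowP => j; rewrite !mxE liftK.
Qed.

Section lebesgue_cons.
Variables (n : nat) (mu : {sigma_finite_measure set 'rV[R]_n -> \bar R}).

Definition lebesgue_cons : set 'rV[R]_n.+1 -> \bar R :=
  pushforward (lebesgue_measure \x mu)%E (@rV_cons n).

HB.instance Definition _ := Measure.copy lebesgue_cons
  (measure_function_pushforward__canonical__measure_function_Measure
    (lebesgue_measure \x mu)%E (measurable_rV_cons (n := n))).

(* The library's sigma-finite instance on \x is not found by unification, hence
   a direct proof. *)
Let lebesgue_cons_sigma_finite : sigma_finite setT lebesgue_cons.
Proof.
have /sigma_finiteP[F [TF ndF Foo]] := sigma_finiteT (@lebesgue_measure R).
have /sigma_finiteP[G [TG ndG Goo]] := sigma_finiteT mu.
exists (fun k => @rV_uncons n @^-1` (F k `*` G k)).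
  rewrite -preimage_bigcup; apply/esym/seteqP; split => // x _ /=.
  have [j _ Fj] : (\bigcup_i F i) (rV_uncons x).1 by rewrite -TF.
  have [k _ Gk] : (\bigcup_i G i) (rV_uncons x).2 by rewrite -TG.
  exists (maxn j k) => //; split.
    by move: (_.1) Fj; exact/subsetPset/ndF/leq_maxl.
  by move: (_.2) Gk; exact/subsetPset/ndG/leq_maxr.
move=> k; have [[mFk Fk] [mGk Gk]] := (Foo k, Goo k); split.
  rewrite -[X in measurable X]setTI.
  by apply: measurable_rV_uncons => //; exact: measurableX.
rewrite /lebesgue_cons /pushforward -comp_preimage.
rewrite (_ : _ \o _ = idfun); last by apply/funext => p; exact: rV_consK.
by rewrite preimage_id product_measure1E// lte_mul_pinfty// ge0_fin_numE.
Qed.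

HB.instance Definition _ := Measure_isSigmaFinite.Build _ _ _
  lebesgue_cons lebesgue_cons_sigma_finite.

End lebesgue_cons.

(* n-dimensional Lebesgue measure, as an iterated product; lebesgue_rV_box
   characterizes it. *)
Fixpoint lebesgue_rV n : {sigma_finite_measure set 'rV[R]_n -> \bar R} :=
  match n with
  | 0 => dirac (0 : 'rV[R]_0)
  | n'.+1 => lebesgue_cons (lebesgue_rV n')
  end.

Lemma lebesgue_rV_box n (A : 'I_n -> set TR) :
  (forall i, measurable (A i)) ->
  lebesgue_rV n [set x | forall i, A i (x ord0 i)] =
  (\prod_(i < n) lebesgue_measure (A i))%E.
Proof.
elim: n A => [|n IHn] A mA.
  by rewrite big_ord0 /= diracE mem_set// => -[].
rewrite big_ord_recl /= /lebesgue_cons /pushforward.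
rewrite (_ : _ @^-1` _ = A ord0 `*`
    [set x : 'rV[R]_n | forall i, A (lift ord0 i) (x ord0 i)]).
  rewrite product_measure1E//; first by rewrite (IHn (fun i => A (lift ord0 i))).
  rewrite (_ : mkset _ = \bigcap_(i in [set: 'I_n])
      ((fun x : 'rV[R]_n => x ord0 i) @^-1` A (lift ord0 i))).
    apply: fin_bigcap_measurable => // i _.
    rewrite -[X in measurable X]setTI.
    by apply: (@measurable_coord _ R n i measurableT); exact: mA.
  by apply/seteqP; split => x /= Ax i; [move=> _; exact: Ax|exact: (Ax i)].
apply/seteqP; split => -[a x] /=.
  move=> Ax; split.
    by have := Ax ord0; rewrite mxE unlift_none.
  by move=> i; have := Ax (lift ord0 i); rewrite mxE liftK.
move=> [Aa Ax] i; rewrite mxE.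
by have [j ->|->] := unliftP ord0 i; [rewrite ?liftK/=; exact: Ax|rewrite ?unlift_none].
Qed.

End lebesgue_rV.

(* A vector-, matrix- or tensor-valued map on R^n is a function
   'rV[R]_n -> K -> R, with K the finite type of component indices:
   'I_N for u, 'I_N * 'I_n for its gradient (component (i, alpha) is
   d_alpha u^i), 'I_N * 'I_N * 'I_n * 'I_n for the coefficients (component
   (i, j, alpha, beta) is A_ij^{alpha beta}). *)
Section function_spaces.
Context {R : realType}.

(* The library norm on 'rV[R]_n is the sup norm, and its balls are cubes. *)
Definition enorm (K : finType) (v : K -> R) : R :=
  Num.sqrt (\sum_k v k ^+ 2).

Definition eball n (x : 'rV[R]_n) (r : R) : set 'rV[R]_n :=
  [set y | enorm ((y - x) ord0) < r].

Definition mean n (E : set 'rV[R]_n) (f : 'rV[R]_n -> R) : R :=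
  (fine (lebesgue_rV n E))^-1 * \int[lebesgue_rV n]_(x in E) f x.

Definition mean_osc n (K : finType) (p : nat) (E : set 'rV[R]_n)
    (f : 'rV[R]_n -> K -> R) : \bar R :=
  ((fine (lebesgue_rV n E))^-1%:E *
   \int[lebesgue_rV n]_(y in E)
     (enorm (fun k => f y k - mean E (f^~ k)) ^+ p)%:E)%E.

Definition omega2 n (K : finType) (f : 'rV[R]_n -> K -> R) (r : R) : \bar R :=
  ereal_sup
    [set (mean_osc 2 (eball x r) f `^ 2^-1)%E | x in eball (0 : 'rV[R]_n) 2].

Definition L2 n (K : finType) (D : set 'rV[R]_n) (f : 'rV[R]_n -> K -> R) :=
  forall k, measurable_fun D (f^~ k) /\
    (lebesgue_rV n).-integrable D (fun x => (f x k ^+ 2)%:E).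

Definition Linfty_loc n (K : finType) (D : set 'rV[R]_n)
    (f : 'rV[R]_n -> K -> R) :=
  (forall k, measurable_fun D (f^~ k)) /\
  forall C : set 'rV[R]_n, compact C -> C `<=` D ->
    exists M : R, {ae lebesgue_rV n, forall x, C x -> enorm (f x) <= M}.

Definition vmo_modulus n (K : finType) (D : set 'rV[R]_n)
    (f : 'rV[R]_n -> K -> R) (r : R) : \bar R :=
  ereal_sup [set z | exists x s,
    [/\ D x, 0 < s <= r & z = mean_osc 1 (eball x s `&` D) f]].

(* VMO of a bounded domain D: integrable, of bounded mean oscillation, with
   the oscillation over balls (intersected with D) of radius at most r
   vanishing uniformly as r -> 0. *)
Definition VMO n (K : finType) (D : set 'rV[R]_n) (f : 'rV[R]_n -> K -> R) :=
  [/\ forall k, (lebesgue_rV n).-integrable D (fun x => (f x k)%:E),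
      exists M : R, forall r, (vmo_modulus D f r <= M%:E)%E &
      vmo_modulus D f r @[r --> 0^'+] --> 0%E].

Definition partial n (i : 'I_n) (f : 'rV[R]_n -> R) : 'rV[R]_n -> R :=
  'D_(delta_mx ord0 i) f.

(* C^oo: every iterated partial derivative exists and is continuous. *)
Definition smooth n (f : 'rV[R]_n -> R) :=
  forall s : seq 'I_n, let g := foldr (@partial n) f s in
    continuous g /\ forall i x, derivable g x (delta_mx ord0 i).

Definition test_function n (D : set 'rV[R]_n) (f : 'rV[R]_n -> R) :=
  let supp := closure [set x | f x != 0] in
  [/\ smooth f, compact supp & supp `<=` D].

Definition weak_partial n (D : set 'rV[R]_n) (i : 'I_n)
    (u g : 'rV[R]_n -> R) :=
  forall eta, test_function D eta ->
    (\int[lebesgue_rV n]_(x in D) (u x * partial i eta x)%:E =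
     - \int[lebesgue_rV n]_(x in D) (g x * eta x)%:E)%E.

(* u is in H^1(D), with weak gradient Du. *)
Definition sobolev_H1 n (K : finType) (D : set 'rV[R]_n)
    (u : 'rV[R]_n -> K -> R) (Du : 'rV[R]_n -> K * 'I_n -> R) :=
  [/\ L2 D u, L2 D Du &
      forall k a, weak_partial D a (u^~ k) (Du^~ (k, a))].

(* u is in H^1_0(D), the closure of C_c^oo(D) in H^1(D), with weak gradient
   Du. *)
Definition sobolev_H10 n (K : finType) (D : set 'rV[R]_n)
    (u : 'rV[R]_n -> K -> R) (Du : 'rV[R]_n -> K * 'I_n -> R) :=
  sobolev_H1 D u Du /\
  forall e : R, 0 < e -> exists psi : 'rV[R]_n -> K -> R,
    (forall k, test_function D (psi^~ k)) /\
    (\int[lebesgue_rV n]_(x in D)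
       (enorm (fun k => u x k - psi x k) ^+ 2 +
        enorm (fun p => Du x p - partial p.2 (psi^~ p.1) x) ^+ 2)%:E
     < e%:E)%E.

Definition weak_solution n N (D : set 'rV[R]_n)
    (A : 'rV[R]_n -> 'I_N * 'I_N * 'I_n * 'I_n -> R)
    (Du : 'rV[R]_n -> 'I_N * 'I_n -> R) :=
  forall (i : 'I_N) (eta : 'rV[R]_n -> R), test_function D eta ->
    (\int[lebesgue_rV n]_(x in D)
       (\sum_(a < n) \sum_(b < n) \sum_(j < N)
          A x (i, j, a, b) * Du x (j, b) * partial a eta x)%:E = 0)%E.

End function_spaces.

(* Main.v *)
Require Import Defs.
From HB Require Import structures.
From mathcomp Require Import all_boot all_order all_algebra.
From mathcomp Require Import all_classical all_reals all_analysis.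
From mathcomp Require Import measurable_realfun.
From mathcomp Require Import ring lra.

Set Implicit Arguments.
Unset Strict Implicit.
Unset Printing Implicit Defensive.

Import Order.TTheory GRing.Theory Num.Theory.
Import numFieldNormedType.Exports.

Local Open Scope classical_set_scope.
Local Open Scope ring_scope.

(** The example is radial up to one coordinate. Write r for |x|, l for
    10 - ln r and G for l ^ g with 0 < g <= 1/2, and set u = x_o G for a fixed
    coordinate o; all N components of the solution are equal to u. Its gradient
    G e_o + r G' (x_o / r) (x / r) is unbounded at the origin because G is, and
    has vanishing mean oscillation because r G' = - g l ^ (g - 1) tends to 0.

    Coefficients. For any radial phi, the matrix
    phi (delta_oa x_c - delta_oc x_a) is antisymmetric, so the divergence of its
    divergence vanishes: the flux
    V_a = ((n - 1) phi + r phi') delta_oa - r phi' x_o x_a / r^2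
    is divergence free. With phi = (G + r G') / (n - 1) the radial components
    of V and of the gradient of u agree, and V = A grad u for the matrix A with
    eigenvalue 1 in the radial direction and 1 - m in the tangential ones, where
    m is a polynomial in 1 / l without constant term (defect, flux_eq). Since
    m <= 3 g / l, this A is continuous, with A = I at the origin, and its bounds
    lam = 1/2 and Lam do not depend on g.

    Equation. Both u and x_c phi are differentiable off the origin, with
    integrable derivatives. As n >= 2, almost every line parallel to an axis
    avoids the origin, so integration by parts on lines (weak_partial_punctured)
    shows that the classical derivatives are the weak ones. Testing the equation
    with eta then leaves x_c phi against d_c d_o eta - d_o d_c eta, which is zero
    (partialC, integral_curl0).

    Oscillation. A function m >= 0 of r with m nondecreasing and m / r
    nonincreasing (submodulus) gives a tensor m x_a x_b / r^2 with oscillation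
    O(m (t)) at scale t (tensor_osc). Hence the modulus omega of A is at most
    k / l with k a fixed multiple of g. The constant C_* being fixed by lam
    and Lam, g can be taken so small that C_* k <= 1/2; the exponential is then at
    most l ^ (1/2), and the quantity in the smallness condition is
    O(l ^ (-1/2)) (limf_esup_dini).

    Mean oscillation of the gradient. On a ball of radius s whose centre is at
    distance at least 4 s from the origin, the gradient oscillates by
    O(l (s) ^ (g - 1)) uniformly. On the other balls G - G (5 s) is at most
    l (5 s) ^ (g - 1) times ln (5 s / r), and the mean of that logarithm is bounded,
    as a comparison with dyadic cubes shows (integral_ln_len). *)

(** * Euclidean norm and balls *)

Section enorm.
Context {R : realType}.

Definition esq (K : finType) (v : K -> R) : R := \sum_k v k ^+ 2.

Lemma esq_ge0 (K : finType) (v : K -> R) : 0 <= esq v.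
Proof. by apply: sumr_ge0 => k _; exact: sqr_ge0. Qed.

Lemma enorm_ge0 (K : finType) (v : K -> R) : 0 <= enorm v.
Proof. exact: sqrtr_ge0. Qed.

Lemma sqr_enorm (K : finType) (v : K -> R) : enorm v ^+ 2 = esq v.
Proof. by rewrite sqr_sqrtr // esq_ge0. Qed.

Lemma le_sqr_esq (K : finType) (v : K -> R) k : v k ^+ 2 <= esq v.
Proof.
by rewrite /esq (bigD1 k) //= lerDl; apply: sumr_ge0 => j _; exact: sqr_ge0.
Qed.

Lemma le_abs_enorm (K : finType) (v : K -> R) k : `|v k| <= enorm v.
Proof.
rewrite -(@ler_pXn2r _ 2) ?nnegrE ?enorm_ge0 //.
by rewrite sqr_enorm real_normK ?num_real // le_sqr_esq.
Qed.

Lemma enorm_le_sum (K : finType) (v : K -> R) : enorm v <= \sum_k `|v k|.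
Proof.
rewrite -(@ler_pXn2r _ 2) ?nnegrE ?enorm_ge0 ?sumr_ge0 // sqr_enorm.
rewrite expr2 mulr_suml; apply: ler_sum => k _.
rewrite -real_normK ?num_real // expr2 ler_wpM2l //.
by rewrite (bigD1 k) //= lerDl sumr_ge0.
Qed.

Lemma enorm_le_card (K : finType) (v : K -> R) M :
  (forall k, `|v k| <= M) -> enorm v <= #|K|%:R * M.
Proof.
move=> vM; apply: (le_trans (enorm_le_sum v)).
by rewrite mulr_natl -sumr_const; apply: ler_sum => k _.
Qed.

Lemma eq_enorm (K : finType) (v w : K -> R) : v =1 w -> enorm v = enorm w.
Proof. by move=> vw; rewrite /enorm; under eq_bigr do rewrite vw. Qed.

Lemma enormN (K : finType) (v : K -> R) : enorm (fun k => - v k) = enorm v.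
Proof. by rewrite /enorm; under eq_bigr do rewrite sqrrN. Qed.

Lemma cauchy_schwarz (K : finType) (v w : K -> R) :
  (\sum_k v k * w k) ^+ 2 <= esq v * esq w.
Proof.
set c := \sum_k _.
have [w0|w0] := eqVneq (esq w) 0.
  have wk k : w k = 0.
    by apply/eqP; rewrite -sqrf_eq0 eq_le sqr_ge0 andbT -w0 le_sqr_esq.
  by rewrite /c big1 ?expr0n ?w0 ?mulr0 // => k _; rewrite wk mulr0.
have wp : 0 < esq w by rewrite lt_neqAle eq_sym w0 esq_ge0.
have : 0 <= \sum_k (esq w * v k - c * w k) ^+ 2.
  by apply: sumr_ge0 => k _; exact: sqr_ge0.
have -> : \sum_k (esq w * v k - c * w k) ^+ 2 =
          esq w * (esq v * esq w - c ^+ 2).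
  transitivity (\sum_k (esq w ^+ 2 * v k ^+ 2 -
                        2 * esq w * c * (v k * w k) + c ^+ 2 * w k ^+ 2)).
    by apply: eq_bigr => k _; ring.
  rewrite big_split sumrB -!mulr_sumr -/c -/(esq v) -/(esq w) /=; ring.
by rewrite pmulr_rge0 // subr_ge0.
Qed.

Lemma enorm_triangle (K : finType) (v w : K -> R) :
  enorm (fun k => v k + w k) <= enorm v + enorm w.
Proof.
rewrite -(@ler_pXn2r _ 2) ?nnegrE ?addr_ge0 ?enorm_ge0 // sqrrD !sqr_enorm.
have -> : esq (fun k => v k + w k) =
          esq v + (\sum_k v k * w k) *+ 2 + esq w.
  rewrite /esq -sumrMnl -!big_split /=; apply: eq_bigr => k _.
  by rewrite sqrrD.
rewrite lerD2r lerD2l lerMn2r /=.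
apply: (le_trans (ler_norm _)).
rewrite -(@ler_pXn2r _ 2) ?nnegrE ?mulr_ge0 ?enorm_ge0 //.
by rewrite real_normK ?num_real // exprMn !sqr_enorm cauchy_schwarz.
Qed.

Lemma enormZ (K : finType) (a : R) (v : K -> R) :
  enorm (fun k => a * v k) = `|a| * enorm v.
Proof.
rewrite /enorm; under eq_bigr do rewrite exprMn.
by rewrite -mulr_sumr sqrtrM ?sqr_ge0 // sqrtr_sqr.
Qed.

Section rV.
Variable n : nat.
Implicit Types x y z : 'rV[R]_n.

Definition len x : R := enorm (x ord0).

Lemma len_ge0 x : 0 <= len x. Proof. exact: enorm_ge0. Qed.

Lemma len0 : len 0 = 0.
Proof.
by rewrite /len /enorm big1 ?sqrtr0 // => i _; rewrite mxE expr0n.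
Qed.

Lemma lenN x : len (- x) = len x.
Proof. by rewrite /len -[RHS]enormN; apply: eq_enorm => i; rewrite mxE. Qed.

Lemma lenC x y : len (x - y) = len (y - x).
Proof. by rewrite -lenN opprB. Qed.

Lemma len_triangle x y : len (x + y) <= len x + len y.
Proof.
apply: le_trans (enorm_triangle _ _); rewrite /len.
by rewrite (@eq_enorm _ _ (fun k => x ord0 k + y ord0 k)) // => i; rewrite mxE.
Qed.

Lemma len_dist x y : len x <= len y + len (x - y).
Proof. by rewrite -{1}(subrKC y x) len_triangle. Qed.

Lemma lenZ a x : len (a *: x) = `|a| * len x.
Proof.
by rewrite /len -enormZ; apply: eq_enorm => i; rewrite mxE.
Qed.

Lemma le_coord_len x i : `|x ord0 i| <= len x.
Proof. exact: (le_abs_enorm (x ord0)). Qed.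

Lemma sqr_len x : len x ^+ 2 = \sum_i x ord0 i ^+ 2.
Proof. exact: sqr_enorm. Qed.

Lemma len_gt0 x i : x ord0 i != 0 -> 0 < len x.
Proof. by move=> xi; apply: lt_le_trans (le_coord_len x i); rewrite normr_gt0. Qed.

Lemma neq0_coord x : x != 0 -> exists i, x ord0 i != 0.
Proof.
move=> x0; apply/existsP; apply: contraNT x0 => /existsPn x0.
by apply/eqP/rowP => i; rewrite mxE; have := x0 i; rewrite negbK => /eqP.
Qed.

Lemma neq0_len_gt0 x : x != 0 -> 0 < len x.
Proof. by move=> /neq0_coord[i]; exact: len_gt0. Qed.

Lemma eballE x r : eball x r = [set y | len (y - x) < r].
Proof. by []. Qed.

Lemma eball0E r : eball (0 : 'rV[R]_n) r = [set y | len y < r].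
Proof. by rewrite eballE; apply/seteqP; split => y /=; rewrite subr0. Qed.

End rV.
End enorm.

(** * Measure-theoretic preliminaries *)

Section integral_monotone.
Local Open Scope ereal_scope.

(** Monotonicity without measurability, immediate from the definition of the
    integral of a nonnegative function as a supremum over simple functions; it
    serves for integrands built on the oscillation modulus, whose measurability
    in the radius is not obvious. *)
Lemma le_integral_nomeas d (T : measurableType d) (R : realType)
    (mu : {measure set T -> \bar R}) (D : set T) (f g : T -> \bar R) :
  (forall x, D x -> 0 <= f x) -> (forall x, D x -> f x <= g x) ->
  \int[mu]_(x in D) f x <= \int[mu]_(x in D) g x.
Proof.
move=> f0 fg; have g0 x : D x -> 0 <= g x.
  by move=> Dx; apply: le_trans (fg _ Dx); exact: f0.
rewrite !ge0_integralE //; apply: le_ereal_sup => _ [h hf <-].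
exists h => // x; apply: le_trans (hf x) _.
by apply: lee_restrict.
Qed.

End integral_monotone.

Section rV_measure.
Context {R : realType}.
Local Notation TR := (measurableTypeR R).
Local Notation mu := (@lebesgue_rV R).

Lemma measurable_coordR n (i : 'I_n) :
  measurable_fun [set: 'rV[R]_n] (fun x => x ord0 i : R).
Proof. exact: (@measurable_coord _ TR). Qed.

Lemma measurable_enorm d (T : measurableType d) (K : finType) (D : set T)
    (f : T -> K -> R) : (forall k, measurable_fun D (f^~ k)) ->
  measurable_fun D (fun x => enorm (f x)).
Proof.
move=> mf; rewrite /enorm.
apply: (@measurableT_comp _ _ _ _ _ _ (@Num.sqrt R)).
  by apply: continuous_measurable_fun; exact: sqrt_continuous.
by apply: measurable_sum => k; apply: measurable_funX.
Qed.

Lemma measurable_len n : measurable_fun [set: 'rV[R]_n] (@len R n).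
Proof. by apply: measurable_enorm => k; exact: measurable_coordR. Qed.

Lemma measurable_len_sub n (x : 'rV[R]_n) :
  measurable_fun [set: 'rV[R]_n] (fun y => len (y - x)).
Proof.
apply: measurable_enorm => k.
rewrite (_ : (fun _ => _) = (fun y : 'rV[R]_n => y ord0 k - x ord0 k)).
  by apply: measurable_funB => //; exact: measurable_coordR.
by apply/funext => y; rewrite !mxE.
Qed.

Lemma measurable_eball n (x : 'rV[R]_n) r : measurable (eball x r).
Proof.
rewrite eballE.
rewrite (_ : mkset _ = (fun y => len (y - x)) @^-1` `]-oo, r[); last first.
  by apply/seteqP; split => y /=; rewrite in_itv.
by rewrite -[X in measurable X]setTI; apply: measurable_len_sub.
Qed.

(** The closed cube; it plays for Lebesgue measure the role of a ball, its
    volume being explicit. *)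
Definition cube n (x : 'rV[R]_n) (s : R) : set 'rV[R]_n :=
  [set y | forall i, `|y ord0 i - x ord0 i| <= s].

Lemma cubeE n (x : 'rV[R]_n) s : cube x s =
  [set y | forall i, `[x ord0 i - s, x ord0 i + s]%classic (y ord0 i)].
Proof.
by apply/seteqP; split => y /= h i; have := h i; rewrite in_itv /= ler_distl.
Qed.

Lemma measurable_cube n (x : 'rV[R]_n) s : measurable (cube x s).
Proof.
rewrite (_ : cube x s = \bigcap_(i in [set: 'I_n])
   ((fun y : 'rV[R]_n => y ord0 i) @^-1` `[x ord0 i - s, x ord0 i + s])).
  apply: fin_bigcap_measurable => // i _.
  by rewrite -[X in measurable X]setTI; apply: measurable_coordR.
by rewrite cubeE; apply/seteqP; split => y /= h i; [move=> _|]; exact: h.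
Qed.

Lemma lebesgue_cube n (x : 'rV[R]_n) s : 0 <= s ->
  mu n (cube x s) = ((2 * s) ^+ n)%:E.
Proof.
move=> s0.
rewrite cubeE (lebesgue_rV_box (A := fun i => `[x ord0 i - s, x ord0 i + s]%classic)) //.
rewrite (eq_bigr (fun=> (2 * s)%:E)); last first.
  move=> i _; rewrite lebesgue_measure_itv /= lte_fin.
  by case: ltP => h; rewrite -?EFinB; congr EFin; lra.
by rewrite prodEFin prodr_const card_ord.
Qed.

Lemma cube_sub_eball n (x : 'rV[R]_n) s r : n%:R * s < r -> cube x s `<=` eball x r.
Proof.
move=> sr y yx; rewrite eballE /=; apply: le_lt_trans sr.
have := @enorm_le_card R _ ((y - x) ord0) s; rewrite card_ord; apply => i.
by rewrite !mxE; apply: yx.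
Qed.

Lemma eball_sub_cube n (x : 'rV[R]_n) r : eball x r `<=` cube x r.
Proof.
move=> y; rewrite eballE /= => /ltW yx i; apply: le_trans yx.
by have := le_coord_len (y - x) i; rewrite !mxE.
Qed.

Lemma eball_lty n (x : 'rV[R]_n) r : (mu n (eball x r) < +oo)%E.
Proof.
have [r0|r0] := leP 0 r; last first.
  rewrite (_ : eball x r = set0) ?measure0 //.
  apply/seteqP; split => // y; rewrite eballE /= => yr.
  by have := len_ge0 (y - x); rewrite leNgt (lt_trans yr).
apply: (@le_lt_trans _ _ (mu n (cube x r))).
  by apply: le_measure; rewrite ?inE; [exact: measurable_eball|
    exact: measurable_cube|exact: eball_sub_cube].
by rewrite lebesgue_cube // ltry.
Qed.

(** The volume is bounded below by that of an inscribed cube, which avoids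
    computing the volume of a Euclidean ball. *)
Lemma le_measure_eball n (x z : 'rV[R]_n) (r s : R) (E : set 'rV[R]_n) :
  (0 < n)%N -> 0 < r -> measurable E -> eball z r `<=` E -> E `<=` eball x s ->
  (mu n E < +oo)%E /\ (r / n%:R) ^+ n <= fine (mu n E).
Proof.
move=> n0 r0 mE zE Ex.
have Efin : (mu n E < +oo)%E.
  apply: le_lt_trans (eball_lty x s).
  by apply: le_measure; rewrite ?inE //; exact: measurable_eball.
split=> //.
have nR : 0 < n%:R :> R by rewrite ltr0n.
rewrite -lee_fin fineK ?ge0_fin_numE //.
have t0 : 0 <= r / n%:R / 2 by rewrite !divr_ge0 // ltW.
have -> : r / n%:R = 2 * (r / n%:R / 2) by field; rewrite gt_eqF.
rewrite -(lebesgue_cube z t0).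
apply: le_measure; rewrite ?inE //; first exact: measurable_cube.
apply: subset_trans zE; apply: cube_sub_eball.
have -> : n%:R * (r / n%:R / 2) = r / 2 by field; rewrite gt_eqF.
by lra.
Qed.

Lemma cube0E n : cube (0 : 'rV[R]_n) 0 = [set 0].
Proof.
apply/seteqP; split => [y h|_ -> i]; last by rewrite subrr normr0.
apply/rowP => i; have := h i; rewrite !mxE subr0 normr_le0 => /eqP //.
Qed.

Lemma measurable_origin n : measurable [set (0 : 'rV[R]_n)].
Proof. by rewrite -cube0E; exact: measurable_cube. Qed.

Lemma origin_null n : (0 < n)%N -> mu n [set 0] = 0%E.
Proof.
by move=> n0; rewrite -cube0E lebesgue_cube // mulr0 expr0n; case: n n0.
Qed.

End rV_measure.

Section continuous_measurable.
Context {R : realType}.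

(** An open set is the union of the countably many cubes centred at points
    with coordinates in 1/(k+1) Z, and of half-side 1/(k+1), that it contains. *)
Lemma open_measurable_rV n (U : set 'rV[R]_n) : open U -> measurable U.
Proof.
move=> oU.
pose c (zk : 'rV[int]_n * nat) : 'rV[R]_n :=
  \row_i ((zk.1 ord0 i)%:~R / zk.2.+1%:R).
pose Q (zk : 'rV[int]_n * nat) := cube (c zk) (zk.2.+1%:R^-1).
rewrite (_ : U = \bigcup_zk (if `[< Q zk `<=` U >] then Q zk else set0)).
  apply: countable_bigcupT_measurable => // zk.
  by case: ifP => // _; exact: measurable_cube.
apply/seteqP; split => x; last first.
  by move=> [zk _]; case: ifPn => // /asboolP; apply.
move=> Ux; have := oU; rewrite openE => /(_ _ Ux) /nbhs_ballP [e /= e0 eU].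
have [k kP] : exists k : nat, 2 / k.+1%:R < e.
  have /ltr_add_invr[k] : 0 < e / 2 by rewrite divr_gt0.
  rewrite add0r => ke; exists k.
  by rewrite mulrC -ltr_pdivlMr.
pose z : 'rV[int]_n := \row_i Num.floor (x ord0 i * k.+1%:R).
have kp : 0 < k.+1%:R :> R by [].
have xz i : 0 <= x ord0 i - c (z, k) ord0 i <= k.+1%:R^-1.
  rewrite !mxE /=; set w := x ord0 i.
  have /andP[h1 h2] := floor_itv (w * k.+1%:R).
  rewrite subr_ge0 ler_pdivrMr // h1 /= lerBlDr -[X in _ <= X + _]mul1r.
  rewrite -mulrDl ler_pdivlMr // addrC.
  by have := ltW h2; rewrite intrD.
exists (z, k) => //; case: ifPn => [_|/asboolPn []].
  by move=> i; have /andP[h1 h2] := xz i; rewrite ger0_norm.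
move=> y Qy; apply: eU; split => // i j; rewrite /ball /= (ord1 i).
apply: le_lt_trans kP; have := Qy j; have /andP[h1 h2] := xz j.
rewrite /= -(ger0_norm h1) in h2; move=> h3.
rewrite (_ : x ord0 j - y ord0 j =
  (x ord0 j - c (z, k) ord0 j) - (y ord0 j - c (z, k) ord0 j)); last by ring.
by apply: (le_trans (ler_normB _ _)); rewrite mulr_natl mulr2n lerD.
Qed.

Lemma continuous_measurable_rV n (f : 'rV[R]_n -> R) :
  continuous f -> measurable_fun setT f.
Proof.
move=> /continuousP cf.
apply: (measurability _ (RGenOpens.measurableE R)) => _ [_ [a [b ->] <-]].
by rewrite setTI; apply: open_measurable_rV; apply: cf; exact: interval_open.
Qed.

End continuous_measurable.

(** * Integration along the lines parallel to an axis *)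

Section lines.
Context {R : realType}.
Local Notation TR := (measurableTypeR R).
Local Notation mu := (@lebesgue_rV R).
Local Notation leb := (@lebesgue_measure R).
Local Open Scope ereal_scope.

Lemma integrable_rV_cons n (f : 'rV[R]_n.+1 -> \bar R) :
  (mu n.+1).-integrable setT f ->
  (leb \x mu n).-integrable setT (f \o @rV_cons R n).
Proof.
move=> /integrableP[mf foo]; apply/integrableP; split.
  exact: measurableT_comp mf (@measurable_rV_cons R n).
rewrite (le_lt_trans _ foo) //.
have := @ge0_integral_pushforward _ _ _ _ R _ (@measurable_rV_cons R n)
  (leb \x mu n) setT (abse \o f) measurableT.
rewrite preimage_setT => <- //.
  exact: measurableT_comp.
by move=> y _ /=.
Qed.

Lemma integral_rV_cons n (f : 'rV[R]_n.+1 -> \bar R) :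
  (mu n.+1).-integrable setT f ->
  \int[mu n.+1]_x f x = \int[leb \x mu n]_p f (rV_cons p).
Proof.
move=> fi; have /integrableP[mf _] := fi.
have := @integral_pushforward _ _ _ _ R _ (@measurable_rV_cons R n)
  (leb \x mu n) setT f mf.
by rewrite preimage_setT => <- //; exact: integrable_rV_cons.
Qed.

Definition set_coord n (b : 'I_n) (x : 'rV[R]_n) (t : R) : 'rV[R]_n :=
  \row_i if i == b then t else x ord0 i.

Lemma set_coord_cons0 n (y : 'rV[R]_n) (s t : R) :
  set_coord ord0 (rV_cons (s, y)) t = rV_cons (t, y).
Proof.
apply/rowP => i; rewrite !mxE /=.
by have [j ->|->] := unliftP ord0 i.
Qed.

Lemma set_coord_cons_lift n (b : 'I_n) (y : 'rV[R]_n) (s t : R) :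
  set_coord (lift ord0 b) (rV_cons (s, y)) t = rV_cons (s, set_coord b y t).
Proof.
apply/rowP => i; rewrite !mxE /=.
have [j ->|->] /= := unliftP ord0 i; last by [].
by rewrite (inj_eq lift_inj) !mxE.
Qed.

Lemma integral_lines0 n (b : 'I_n) (f : 'rV[R]_n -> \bar R) :
  (mu n).-integrable setT f ->
  (forall x, \int[leb]_t f (set_coord b x t) = 0) ->
  \int[mu n]_x f x = 0.
Proof.
elim: n b f => [[]//|n IH] b f fi f0.
rewrite integral_rV_cons //; have gi := integrable_rV_cons fi.
have [j bE|b0] := unliftP ord0 b; last first.
  rewrite -integral21_prod_meas1 //; apply: integral0_eq => y _.
  rewrite /fubini_G /= -[RHS](f0 (rV_cons (0%R, y))) b0.
  by apply: eq_integral => t _; rewrite set_coord_cons0.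
rewrite -integral12_prod_meas1 //.
rewrite (ae_eq_integral (cst 0)) ?integral0 //.
  exact: (measurable_fubini_F gi).
apply: filterS (ae_integrable1 gi) => t /= it _.
apply: (IH j) => // y; rewrite -[RHS](f0 (rV_cons (t, y))) bE.
by apply: eq_integral => s _; rewrite set_coord_cons_lift.
Qed.

(** In dimension at least 2, a line through the origin parallel to a given axis
    is negligible among all lines parallel to this axis. *)
Lemma integral_lines_off0 n (b : 'I_n) (f : 'rV[R]_n -> \bar R) :
  (2 <= n)%N -> (mu n).-integrable setT f ->
  (forall x : 'rV[R]_n, (exists2 j, j != b & x ord0 j != 0%R) ->
    \int[leb]_t f (set_coord b x t) = 0) ->
  \int[mu n]_x f x = 0.
Proof.
case: n b f => [[]//|n] b f n2 fi f0.
rewrite integral_rV_cons //; have gi := integrable_rV_cons fi.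
have [j bE|b0] := unliftP ord0 b; last first.
  rewrite -integral21_prod_meas1 //.
  rewrite (ae_eq_integral (cst 0)) ?integral0 //.
    exact: (measurable_fubini_G gi).
  exists [set 0%R]; split => //; first exact: measurable_origin.
    exact: origin_null.
  move=> y /= h; apply: contrapT => y0; apply: h => _.
  rewrite /fubini_G /=.
  have [j yj] : exists j, y ord0 j != 0%R by apply: neq0_coord; exact/eqP.
  rewrite -[RHS](f0 (rV_cons (0%R, y))); last first.
    by exists (lift ord0 j); rewrite ?b0 // mxE liftK.
  by apply: eq_integral => t _; rewrite b0 set_coord_cons0.
rewrite -integral12_prod_meas1 //.
rewrite (ae_eq_integral (cst 0)) ?integral0 //.
  exact: (measurable_fubini_F gi).
have h0 : {ae leb, forall t : TR, t != 0%R}.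
  exists [set 0%R]; split => //; first exact: lebesgue_measure_set1.
  by move=> t /= /negP; rewrite negbK => /eqP.
apply: (@filterS2 _ _ _ _ _ _ _ h0 (ae_integrable1 gi)) => t /= t0 it _.
apply: (integral_lines0 (b := j)) => // y.
rewrite -[RHS](f0 (rV_cons (t, y))); last first.
  by exists ord0; rewrite ?bE // mxE unlift_none.
by apply: eq_integral => s _; rewrite bE set_coord_cons_lift.
Qed.

End lines.

(** * Test functions *)

Section test_functions.
Context {R : realType}.

Lemma is_derive_line (V : normedModType R) (f : V -> R) (x v : V) (t : R) (a : R) :
  is_derive (x + t *: v) v f a -> is_derive t 1 (fun s : R => f (x + s *: v)) a.
Proof.
move=> [df <-].
have E : (fun h : R => h^-1 *: (((fun s : R => f (x + s *: v)) \o shift t) (h *: (1 : R)) -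
     f (x + t *: v))) =
  (fun h => h^-1 *: ((f \o shift (x + t *: v)) (h *: v) - f (x + t *: v))).
  apply/funext => h /=; congr (_ *: (f _ - _)).
  by rewrite [h *: 1]mulr1 scalerDl addrCA addrA.
by split; [rewrite /derivable E|rewrite /derive E].
Qed.

Lemma continuous_line (V : normedModType R) (x v : V) :
  continuous (fun s : R => x + s *: v).
Proof.
move=> t; apply: cvgD; first exact: cvg_cst.
by apply: cvgZ; [exact: cvg_id|exact: cvg_cst].
Qed.

Lemma continuous_comp_line (V : normedModType R) (f : V -> R) (x v : V) :
  continuous f -> continuous (fun s : R => f (x + s *: v)).
Proof.
move=> cf t; apply: (@continuous_comp _ _ _ (fun s : R => x + s *: v) f).
  exact: continuous_line.
exact: cf.
Qed.

Section smooth.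
Variable n : nat.
Implicit Types (f : 'rV[R]_n -> R) (x : 'rV[R]_n).
Local Notation e i := (delta_mx ord0 i : 'rV[R]_n).

Lemma smooth_continuous f : smooth f -> continuous f.
Proof. by move=> /(_ [::]) []. Qed.

Lemma smooth_is_derive f i x : smooth f -> is_derive x (e i) f (partial i f x).
Proof. by move=> /(_ [::]) [_ /(_ i x)]; exact: derivableP. Qed.

Lemma smooth_partial f i : smooth f -> smooth (partial i f).
Proof. by move=> sf s; have := sf (rcons s i); rewrite foldr_rcons. Qed.

(** The mean value theorem, in each of two directions in turn, writes the second
    difference of f as a value of its mixed derivative; this difference being
    symmetric in the two directions, so are the mixed derivatives. *)
Lemma second_difference f i j x (h : R) : smooth f -> 0 < h ->
  exists s t, [/\ 0 <= s <= h, 0 <= t <= h &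
    f (x + h *: e i + h *: e j) - f (x + h *: e i) - f (x + h *: e j) + f x =
    h ^+ 2 * partial j (partial i f) (x + s *: e i + t *: e j)].
Proof.
move=> sf h0.
pose phi (t : R) := f (x + h *: e j + t *: e i) - f (x + t *: e i).
pose dphi t := partial i f (x + h *: e j + t *: e i) - partial i f (x + t *: e i).
have Dphi (t : R) : is_derive t (1 : R) phi (dphi t).
  by apply: is_deriveB; apply: is_derive_line; exact: smooth_is_derive.
have [|s] := @MVT R phi dphi 0 h h0 (fun t _ => Dphi t).
  apply: continuous_subspaceT => t; apply: cvgB.
    exact/continuous_comp_line/smooth_continuous.
  exact/continuous_comp_line/smooth_continuous.
rewrite in_itv /= subr0 => /andP[s0 sh] Es.
pose psi (t : R) := partial i f (x + s *: e i + t *: e j).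
have Dpsi (t : R) : is_derive t (1 : R) psi (partial j (partial i f) (x + s *: e i + t *: e j)).
  by apply: is_derive_line; apply: smooth_is_derive; exact: smooth_partial.
have [|t] := @MVT R psi _ 0 h h0 (fun t _ => Dpsi t).
  apply: continuous_subspaceT => t.
  exact/continuous_comp_line/smooth_continuous/smooth_partial.
rewrite in_itv /= subr0 => /andP[t0 th] Et.
exists s, t; rewrite !ltW //; split => //.
transitivity (phi h - phi 0).
  by rewrite /phi scale0r !addr0 opprB addrA -(addrA x) [h *: e i + _]addrC addrA; ring.
rewrite Es /dphi -[_ + h *: e j + s *: e i]addrA [h *: e j + _]addrC addrA.
by move: Et; rewrite /psi scale0r addr0 => ->; ring.
Qed.

Lemma partialC f i j x : smooth f ->
  partial i (partial j f) x = partial j (partial i f) x.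
Proof.
move=> sf; apply/eqP; rewrite -subr_eq0 -normr_le0; apply/ler_addgt0Pl => eps eps0.
rewrite addr0.
have cF : {for x, continuous (partial i (partial j f))}.
  by apply: smooth_continuous; do 2 apply: smooth_partial.
have cG : {for x, continuous (partial j (partial i f))}.
  by apply: smooth_continuous; do 2 apply: smooth_partial.
have e2 : 0 < eps / 2 by rewrite divr_gt0.
have /cvgrPdist_lt /(_ _ e2) /nbhs_ballP[d1 /= d10 B1] := cF.
have /cvgrPdist_lt /(_ _ e2) /nbhs_ballP[d2 /= d20 B2] := cG.
pose d := Num.min d1 d2; have d0 : 0 < d by rewrite lt_min d10.
have [dd1 dd2] : d <= d1 /\ d <= d2 by rewrite !ge_min !lexx orbT.
pose h := d / 3; have h0 : 0 < h by rewrite divr_gt0.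
have near_x (s t : R) k l : 0 <= s <= h -> 0 <= t <= h ->
    ball x d (x + s *: e k + t *: e l).
  move=> hs ht; split => // a b; rewrite /ball /= !mxE.
  have hd : h + h < d by rewrite /h; lra.
  have ne (r : R) (c : bool) : 0 <= r <= h -> `|r * c%:R| <= h.
    move=> /andP[r0 rh]; apply: le_trans rh; rewrite normrM ger0_norm //.
    by case: c; rewrite ?normr1 ?normr0 ?mulr1 ?mulr0.
  rewrite -addrA opprD addNKr normrN.
  apply: le_lt_trans hd; apply: (le_trans (ler_normD _ _)).
  by apply: lerD; apply: ne.
have [s [t [hs ht Est]]] := second_difference i j x sf h0.
have [s' [t' [hs' ht' Est']]] := second_difference j i x sf h0.
have h2 : h ^+ 2 != 0 by rewrite expf_neq0 // gt_eqF.
have E : f (x + h *: e i + h *: e j) - f (x + h *: e i) - f (x + h *: e j) + f x =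
         f (x + h *: e j + h *: e i) - f (x + h *: e j) - f (x + h *: e i) + f x.
  by rewrite (addrAC x (h *: e j)); congr (_ + _); exact: addrAC.
move: E; rewrite Est Est' => /(mulfI h2) E {Est Est'}.
have n1 := B1 _ (le_ball dd1 (near_x s' t' j i hs' ht')).
have n2 := B2 _ (le_ball dd2 (near_x s t i j hs ht)).
move: n1 n2; rewrite /= -E => n1 n2.
set p := partial j _ _ in n1 n2.
have -> : partial i (partial j f) x - partial j (partial i f) x =
  (partial i (partial j f) x - p) + (p - partial j (partial i f) x).
  by rewrite addrA subrK.
apply: (le_trans (ler_normD _ _)); rewrite (splitr eps); apply: lerD.
  exact: ltW n1.
by rewrite distrC; exact: ltW n2.
Qed.

End smooth.
End test_functions.

Section test_function_facts.
Context {R : realType}.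
Variable n : nat.
Implicit Types (f eta : 'rV[R]_n -> R) (D : set 'rV[R]_n).
Local Notation e i := (delta_mx ord0 i : 'rV[R]_n).
Local Notation supp f := (closure [set x | f x != 0]).

Lemma notin_supp eta x : ~ supp eta x -> \forall y \near x, eta y = 0.
Proof.
move=> nx; have : nbhs x (~` supp eta).
  by apply: open_nbhs_nbhs; split=> //; rewrite openC; exact: closed_closure.
apply: filterS => y ny; apply: contrapT => /eqP etay; apply: ny.
exact: subset_closure.
Qed.

Lemma partial_notin_supp eta i x : ~ supp eta x -> partial i eta x = 0.
Proof.
move=> /notin_supp h; rewrite /partial (near_eq_derive (g := cst 0)) //.
by rewrite derive_cst.
Qed.

Lemma eta_notin_supp eta x : ~ supp eta x -> eta x = 0.
Proof. by move=> /notin_supp /nbhs_singleton. Qed.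

Lemma test_function_partial D eta i :
  test_function D eta -> test_function D (partial i eta).
Proof.
move=> [se ce De]; have sub : supp (partial i eta) `<=` supp eta.
  have /closure_id -> := @closed_closure _ [set x | eta x != 0].
  apply: closure_subset => x /= /eqP px; apply: contrapT => nx; apply: px.
  exact: partial_notin_supp.
split; first exact: smooth_partial.
- by apply: subclosed_compact ce sub; exact: closed_closure.
- exact: subset_trans De.
Qed.

Lemma test_function_bounded D eta :
  test_function D eta -> exists2 M, 0 <= M & forall x, `|eta x| <= M.
Proof.
move=> [se ce De].
have /compact_bounded[M [Mr hM]] : compact (eta @` supp eta).
  apply: continuous_compact ce.
  exact/continuous_subspaceT/smooth_continuous.
exists (Num.max 0 (M + 1)); first by rewrite le_max lexx.
move=> x; have [sx|nx] := pselect (supp eta x).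
  rewrite le_max; apply/orP; right; apply: (hM (M + 1)); first by rewrite ltrDl.
  by exists x.
by rewrite eta_notin_supp // normr0 le_max lexx.
Qed.

Lemma test_function_measurable D eta :
  test_function D eta -> measurable_fun setT eta.
Proof. by move=> [se _ _]; apply: continuous_measurable_rV; apply: smooth_continuous. Qed.

Lemma integrable_mul_test D f eta : measurable D -> test_function D eta ->
  (lebesgue_rV n).-integrable D (EFin \o f) ->
  (lebesgue_rV n).-integrable D (fun x => (f x * eta x)%:E).
Proof.
move=> mD te fi; have [M M0 eM] := test_function_bounded te.
have mf : measurable_fun D f by apply/measurable_EFinP; case/integrableP: fi.
apply: (@le_integrable _ _ _ _ _ mD _ (fun x => (M%:E * (f x)%:E)%E)).
- apply/measurable_EFinP/measurable_funM => //.
  by apply: measurable_funTS; apply: test_function_measurable te.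
- move=> x Dx; rewrite /= lee_fin !normrM mulrC (ger0_norm M0).
  by rewrite ler_wpM2r.
- exact: integrableZl.
Qed.

End test_function_facts.

(** * Integration by parts across a point singularity *)

Section parts.
Context {R : realType}.
Local Notation leb := (@lebesgue_measure R).
Local Notation mu := (@lebesgue_rV R).

Lemma integral_derivative0 (K k : R -> R) (r : R) : 0 < r ->
  (forall t : R, is_derive t (1 : R) K (k t)) -> continuous k ->
  (forall t, r <= `|t| -> K t = 0 /\ k t = 0) ->
  (\int[leb]_t (k t)%:E = 0)%E.
Proof.
move=> r0 dK ck K0.
have rr : - r < r by rewrite gtrN.
have cK : continuous K.
  by move=> t; apply/differentiable_continuous/derivable1_diffP; case: (dK t).
transitivity (\int[leb]_(t in `[(- r)%R, r]) (k t)%:E)%E.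
  rewrite [RHS]integral_mkcond; apply: eq_integral => t _.
  rewrite patchE; case: ifPn => // /negP; rewrite inE /= in_itv /= -ler_norml.
  by move=> /negP; rewrite -ltNge => /ltW /K0 [_ ->].
rewrite (@continuous_FTC2 _ k K) //.
- have [|-> _] := K0 r; first by rewrite gtr0_norm.
  by have [|-> _] := K0 (- r); rewrite ?normrN ?gtr0_norm // sube0.
- exact: continuous_subspaceT.
- split; first by move=> t _; case: (dK t).
  + by apply: cvg_at_right_filter; exact: cK.
  + by apply: cvg_at_left_filter; exact: cK.
- by move=> t _; rewrite derive1E; apply: derive_val.
Qed.

Variable n : nat.
Hypothesis n2 : (2 <= n)%N.
Local Notation e i := (delta_mx ord0 i : 'rV[R]_n).

Lemma set_coordE (b : 'I_n) (x : 'rV[R]_n) t :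
  set_coord b x t = set_coord b x 0 + t *: e b.
Proof.
apply/rowP => i; rewrite !mxE eqxx /=; case: (i == b).
  by rewrite add0r mulr1.
by rewrite mulr0 addr0.
Qed.

(** Functions that are regular away from the origin have no concentrated part in
    their distributional derivatives: almost every line parallel to a given axis
    avoids the origin when n >= 2, and on such a line the fundamental theorem of
    calculus applies. *)
Lemma weak_partial_punctured (b : 'I_n) (r : R) (w W : 'rV[R]_n -> R) :
  let D := eball (0 : 'rV[R]_n) r in
  0 < r ->
  (forall x, D x -> x != 0 -> is_derive x (e b) w (W x)) ->
  (forall x, D x -> x != 0 -> {for x, continuous w}) ->
  (forall x, D x -> x != 0 -> {for x, continuous W}) ->
  (mu n).-integrable D (EFin \o w) -> (mu n).-integrable D (EFin \o W) ->
  weak_partial D b w W.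
Proof.
move=> D r0 dw cw cW iw iW eta teta.
have mD : measurable D by exact: measurable_eball.
have [se ce De] := teta.
have ceta := smooth_continuous se.
have cdeta := smooth_continuous (smooth_partial b se).
have tdeta := test_function_partial b teta.
have iwd := integrable_mul_test mD tdeta iw.
have iWe := integrable_mul_test mD teta iW.
pose H x := w x * partial b eta x + W x * eta x.
suff HI : (\int[mu n]_(x in D) (H x)%:E = 0)%E.
  move: HI; rewrite (eq_integral (fun x => (w x * partial b eta x)%:E + (W x * eta x)%:E)%E) //.
  rewrite integralD //.
  have fi := integrable_fin_num mD iwd; have fi' := integrable_fin_num mD iWe.
  by move=> h; rewrite -[LHS](addeK _ fi') h add0e.
have HD x : ~ D x -> H x = 0.
  move=> nD; have ns : ~ closure [set x | eta x != 0] x by move=> /De.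
  by rewrite /H (partial_notin_supp b ns) (eta_notin_supp ns) !mulr0 addr0.
have HE : (fun x => (H x)%:E) \_ D = (fun x => (H x)%:E).
  apply/funext => x; rewrite patchE; case: ifPn => // /negP; rewrite inE => nD.
  by rewrite HD.
rewrite integral_mkcond HE.
have iH : (mu n).-integrable setT (fun x => (H x)%:E).
  rewrite -HE; apply/integrable_restrict => //; rewrite setTI.
  exact: (integrableD mD iwd iWe).
apply: (integral_lines_off0 (b := b)) => // x [j jb xj].
pose l t := set_coord b x t.
have lE : l = (fun t => l 0 + t *: e b) by apply/funext => t; exact: set_coordE.
have l0 t : l t != 0.
  apply: contraNneq xj => /rowP /(_ j); rewrite !mxE (negPf jb) => ->.
  by [].
have near_l t (P : set 'rV[R]_n) : nbhs (l t) P -> \forall s \near t, P (l s).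
  have := @continuous_line R _ (l 0) (e b) t; rewrite -lE; exact.
apply: (@integral_derivative0 (fun t => w (l t) * eta (l t)) (fun t => H (l t)) r) => //.
- move=> t; have [st|st] := pselect (closure [set x | eta x != 0] (l t)); last first.
    have h0 : H (l t) = 0.
      by rewrite /H (partial_notin_supp b st) (eta_notin_supp st) !mulr0 addr0.
    rewrite h0; apply: (near_eq_is_derive (f := cst 0)).
    have := near_l _ _ (notin_supp st); apply: filterS => s /= ->.
    by rewrite mulr0.
  rewrite lE; apply: (is_derive_line (f := fun y => w y * eta y)).
  have -> : l 0 + t *: e b = l t by rewrite [in RHS]lE.
  have dwt := dw _ (De _ st) (l0 t).
  have dst := smooth_is_derive b (l t) se.
  apply: is_derive_eq; rewrite /H /GRing.scale /=; ring.
- move=> t.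
  have cl : {for t, continuous l}.
    by rewrite lE; exact: continuous_line.
  apply: (@continuous_comp _ _ _ l H) => //.
  have [st|st] := pselect (closure [set x | eta x != 0] (l t)).
    have cw1 := cw _ (De _ st) (l0 t); have cW1 := cW _ (De _ st) (l0 t).
    exact: (cvgD (cvgM cw1 (cdeta (l t))) (cvgM cW1 (ceta (l t)))).
  have h0 : \forall y \near l t, 0 = H y.
    have : nbhs (l t) (~` closure [set x | eta x != 0]).
      by apply: open_nbhs_nbhs; split=> //; rewrite openC; exact: closed_closure.
    apply: filterS => y ny.
    by rewrite /H (partial_notin_supp b ny) (eta_notin_supp ny) !mulr0 addr0.
  rewrite /prop_for /continuous_at -(nbhs_singleton h0).
  by apply: cvg_trans (near_eq_cvg h0) _; exact: cvg_cst.
- move=> t rt; have ns : ~ closure [set x | eta x != 0] (l t).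
    move=> /De; rewrite /D eball0E /= ltNge => /negP; apply.
    by apply: (le_trans rt); have := le_coord_len (l t) b; rewrite mxE eqxx.
  by rewrite /H (partial_notin_supp b ns) (eta_notin_supp ns) !mulr0 addr0.
Qed.

End parts.

(** * The logarithmic scale *)

Section log_scale.
Context {R : realType}.
Implicit Types r s t x : R.

Lemma ln_le_sub1 x : 0 < x -> ln x <= x - 1.
Proof.
move=> x0; have := expR_ge1Dx (ln x); rewrite lnK ?posrE // => h.
by rewrite lerBrDl.
Qed.

(** The constant 10 only makes the scale at least 7 up to radius 4. *)
Definition ell r : R := 10 - ln r.

Lemma ell_ge7 r : 0 < r -> r <= 4 -> 7 <= ell r.
Proof. by move=> r0 r4; have := ln_le_sub1 r0; rewrite /ell; lra. Qed.

Lemma ell_gt0 r : 0 < r -> r <= 4 -> 0 < ell r.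
Proof. by move=> r0 r4; have := ell_ge7 r0 r4; lra. Qed.

Lemma ell_ratio s r : 0 < s -> 0 < r -> ell s = ell r + ln (r / s).
Proof. by move=> s0 r0; rewrite /ell ln_div ?posrE //; ring. Qed.

Lemma ratio_ge1 s r : 0 < s -> s <= r -> 1 <= r / s.
Proof. by move=> s0 sr; rewrite ler_pdivlMr // mul1r. Qed.

Lemma ell_anti s r : 0 < s -> s <= r -> ell r <= ell s.
Proof.
move=> s0 sr; rewrite (ell_ratio s0 (lt_le_trans s0 sr)) lerDl.
by apply: ln_ge0; exact: ratio_ge1.
Qed.

Lemma ell_large (L : R) : exists2 d, 0 < d & forall r, 0 < r -> r < d -> L < ell r.
Proof.
exists (expR (10 - L)); first exact: expR_gt0.
move=> r r0 rd; rewrite /ell ltrBrDl -ltrBrDr.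
by rewrite -[ltRHS]expRK ltr_ln ?posrE ?expR_gt0.
Qed.

(** Nonnegative, nondecreasing, with m r / r nonincreasing: up to constants these
    are the concave moduli of continuity, and the two monotonicities are all that
    the oscillation estimates use. *)
Definition submodulus (m : R -> R) := forall s r, 0 < s -> s <= r -> r <= 4 ->
  [/\ 0 <= m s, m s <= m r & m r * s <= m s * r].

Lemma submodulusD m1 m2 : submodulus m1 -> submodulus m2 ->
  submodulus (fun r => m1 r + m2 r).
Proof.
move=> h1 h2 s r s0 sr r4; have [a b c] := h1 _ _ s0 sr r4.
have [a' b' c'] := h2 _ _ s0 sr r4.
by split; rewrite ?addr_ge0 ?lerD // !mulrDl lerD.
Qed.

Lemma submodulusZ k m : 0 <= k -> submodulus m -> submodulus (fun r => k * m r).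
Proof.
move=> k0 h s r s0 sr r4; have [a b c] := h _ _ s0 sr r4.
by split; rewrite ?mulr_ge0 ?ler_wpM2l // -!mulrA ler_wpM2l.
Qed.

Lemma submodulus_ge0 m r : submodulus m -> 0 < r -> r <= 4 -> 0 <= m r.
Proof. by move=> h r0 r4; have [] := h _ _ r0 (lexx r) r4. Qed.

Lemma submodulus_scale m s r k : submodulus m -> 0 < s -> s <= 4 ->
  0 < r -> r <= 4 -> 1 <= k -> r <= k * s -> m r <= k * m s.
Proof.
move=> h s0 s4 r0 r4 k1 rk; have ms := submodulus_ge0 h s0 s4.
have [sr|rs] := leP s r.
  have [a b c] := h _ _ s0 sr r4.
  rewrite -(ler_pM2r s0); apply: (le_trans c).
  by rewrite mulrAC [leRHS]mulrC ler_wpM2l.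
have [a b c] := h _ _ r0 (ltW rs) s4.
by apply: (le_trans b); rewrite ler_peMl.
Qed.

Lemma submodulus_sub m s r : submodulus m -> 0 < s -> s <= r -> r <= 4 ->
  `|m r - m s| * s <= m s * (r - s).
Proof.
move=> h s0 sr r4; have [a b c] := h _ _ s0 sr r4.
by rewrite ger0_norm ?subr_ge0 // mulrBl mulrBr lerB.
Qed.

Lemma submodulus_inv_ell : submodulus (fun r => (ell r)^-1).
Proof.
move=> s r s0 sr r4; have r0 := lt_le_trans s0 sr.
have lr := ell_gt0 r0 r4; have ls := ell_gt0 s0 (le_trans sr r4).
have l7 := ell_ge7 r0 r4.
split; first by rewrite invr_ge0 ltW.
  by rewrite lef_pV2 ?posrE // ell_anti.
rewrite ler_pdivrMl // mulrCA ler_pdivlMl // (ell_ratio s0 r0).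
move: (ell r) l7 lr => l l7 lr.
have x1 := ratio_ge1 s0 sr; have := ln_le_sub1 (lt_le_trans ltr01 x1).
set x := r / s in x1 *; have -> : r = s * x by rewrite /x mulrC divfK // gt_eqF.
by move=> hl; rewrite [leLHS]mulrC [leRHS]mulrCA ler_wpM2l ?(ltW s0) //; nra.
Qed.

Lemma submodulus_inv_ell2 : submodulus (fun r => (ell r)^-1 ^+ 2).
Proof.
move=> s r s0 sr r4; have r0 := lt_le_trans s0 sr.
have lr := ell_gt0 r0 r4; have ls := ell_gt0 s0 (le_trans sr r4).
have l7 := ell_ge7 r0 r4.
have [a b _] := submodulus_inv_ell s0 sr r4.
split; first exact: sqr_ge0.
  by rewrite ler_pXn2r ?nnegrE // (le_trans a b).
rewrite !exprVn ler_pdivrMl ?exprn_gt0 // mulrCA ler_pdivlMl ?exprn_gt0 //.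
rewrite (ell_ratio s0 r0); move: (ell r) l7 lr => l l7 lr.
have x1 := ratio_ge1 s0 sr; set x := r / s in x1 *.
have x0 : 0 < x by apply: lt_le_trans x1.
have -> : r = s * x by rewrite /x mulrC divfK // gt_eqF.
pose y := Num.sqrt x; have y0 : 0 < y by rewrite sqrtr_gt0.
have xy : x = y ^+ 2 by rewrite sqr_sqrtr // ltW.
have y1 : 1 <= y by rewrite -(@sqrtr1 R) ler_wsqrtr.
have lxy : ln x = 2 * ln y by rewrite xy lnXn // mulr_natl.
have hl := ln_le_sub1 y0; have ly := ln_ge0 y1.
rewrite [leLHS]mulrC [leRHS]mulrCA ler_wpM2l ?(ltW s0) // lxy xy -exprMn ler_pXn2r // ?nnegrE.
- nra.
- nra.
- by rewrite mulr_ge0 // ltW.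
Qed.

Variable g : R.
Hypotheses (g0 : 0 < g) (g2 : g <= 2^-1).
Let g1 : 0 <= 1 - g. Proof. by move: g2 => h; lra. Qed.
Let g21 : 0 <= 1 - 2 * g. Proof. by move: g2 => h; lra. Qed.

(** prof is the power l ^ g, rprof the unbounded profile of the solution, and g rslope r
    is - r rprof' r. *)
Definition prof (l : R) : R := expR (g * ln l).
Definition rprof r : R := prof (ell r).
Definition rslope r : R := rprof r / ell r.

Lemma rprof_gt0 r : 0 < rprof r. Proof. exact: expR_gt0. Qed.

Lemma rprof_anti s r : 0 < s -> s <= r -> r <= 4 -> rprof r <= rprof s.
Proof.
move=> s0 sr r4; have r0 := lt_le_trans s0 sr.
rewrite /rprof /prof ler_expR ler_wpM2l ?(ltW g0) // ler_ln ?posrE ?ell_gt0 //.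
  exact: ell_anti.
exact: le_trans r4.
Qed.

Lemma rslope_expR r : 0 < r -> r <= 4 -> rslope r = expR ((g - 1) * ln (ell r)).
Proof.
move=> r0 r4; rewrite mulrBl mul1r expRD expRN lnK ?posrE //.
exact: ell_gt0.
Qed.

Lemma ln_ell_ge0 r : 0 < r -> r <= 4 -> 0 <= ln (ell r).
Proof. by move=> r0 r4; apply: ln_ge0; have := ell_ge7 r0 r4; lra. Qed.

Lemma rslope_le1 r : 0 < r -> r <= 4 -> rslope r <= 1.
Proof.
move=> r0 r4; rewrite rslope_expR // -[leRHS]expR0 ler_expR.
have := mulr_ge0 g1 (ln_ell_ge0 r0 r4); lra.
Qed.

Lemma submodulus_rslope : submodulus rslope.
Proof.
move=> s r s0 sr r4; have r0 := lt_le_trans s0 sr.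
have s4 := le_trans sr r4.
have lr := ell_gt0 r0 r4; have ls := ell_gt0 s0 s4.
have [a b c] := submodulus_inv_ell s0 sr r4.
split.
- by rewrite mulr_ge0 // ltW // rprof_gt0.
- rewrite !rslope_expR // ler_expR.
  have h : 0 <= ln (ell s) - ln (ell r) by rewrite subr_ge0 ler_ln ?posrE // ell_anti.
  by have := mulr_ge0 g1 h; lra.
- rewrite /rslope -!mulrA; apply: ler_pM => //; first exact: ltW (rprof_gt0 _).
    by rewrite mulr_ge0 ?(ltW s0) // invr_ge0 ltW.
  exact: rprof_anti.
Qed.

(** Concavity of the power ell ^ g. *)
Lemma rprof_sub s r : 0 < s -> s <= r -> r <= 4 ->
  `|rprof s - rprof r| <= rslope r * ln (r / s).
Proof.
move=> s0 sr r4; have r0 := lt_le_trans s0 sr.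
have s4 := le_trans sr r4.
have lr := ell_gt0 r0 r4; have ls := ell_gt0 s0 s4.
have lrs : ell r <= ell s by exact: ell_anti.
rewrite ger0_norm ?subr_ge0 ?rprof_anti //.
have -> : ln (r / s) = ell s - ell r by rewrite (ell_ratio s0 r0); ring.
rewrite lerBlDl.
have -> : rprof r + rslope r * (ell s - ell r) = rprof r * (ell s / ell r).
  by rewrite /rslope; field; rewrite gt_eqF.
rewrite -[ell s / ell r]lnK ?posrE ?divr_gt0 // /rprof /prof -expRD ler_expR.
rewrite ln_div ?posrE //.
have h : 0 <= ln (ell s) - ln (ell r) by rewrite subr_ge0 ler_ln ?posrE.
by have := mulr_ge0 g1 h; lra.
Qed.

Lemma rslope_small e : 0 < e -> exists2 d, 0 < d & forall r, 0 < r -> r < d -> r <= 4 -> rslope r < e.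
Proof.
move=> e0; have [d d0 dP] := ell_large (expR (- 2 * ln e)); exists d => // r r0 rd r4.
rewrite rslope_expR // -[ltRHS]lnK ?posrE // ltr_expR.
have := dP _ r0 rd; rewrite -[X in _ < X]lnK ?posrE ?ell_gt0 // ltr_expR.
have := mulr_ge0 g21 (ln_ell_ge0 r0 r4); lra.
Qed.

Lemma rprof_large (M : R) : exists2 d, 0 < d & forall r, 0 < r -> r < d -> r <= 4 -> M < rprof r.
Proof.
have [d d0 dP] := ell_large (expR (M / g)); exists d => // r r0 rd r4.
have := dP _ r0 rd; rewrite -[X in _ < X]lnK ?posrE ?ell_gt0 // ltr_expR.
rewrite ltr_pdivrMr // mulrC => h.
have := expR_ge1Dx (g * ln (ell r)); rewrite -/(prof _) -/(rprof r); lra.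
Qed.

End log_scale.

(** * Derivatives of radial functions *)

Section radial_derivative.
Context {R : realType}.
Variable n : nat.
Implicit Types x y : 'rV[R]_n.
Local Notation e i := (delta_mx ord0 i : 'rV[R]_n).

Lemma is_derive_comp1 (f h : R -> R) (t df dh : R) :
  is_derive (h t) (1 : R) f df -> is_derive t (1 : R) h dh ->
  is_derive t (1 : R) (f \o h) (df * dh).
Proof.
move=> [Df vf] [Dh vh]; split.
  have /derivable1_diffP h1 := Dh; have /derivable1_diffP h2 := Df.
  by apply/derivable1_diffP; exact: differentiable_comp h1 h2.
have := @derive1_comp R h f t Dh Df.
by rewrite !derive1E vf vh.
Qed.

Lemma is_derive_of_line (V : normedModType R) (f : V -> R) (x v : V) (a : R) :
  is_derive (0 : R) (1 : R) (fun s : R => f (x + s *: v)) a -> is_derive x v f a.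
Proof.
move=> [df <-].
have E : (fun h : R => h^-1 *: (((fun s : R => f (x + s *: v)) \o shift 0) (h *: (1 : R)) -
     f (x + 0 *: v))) =
  (fun h => h^-1 *: ((f \o shift x) (h *: v) - f x)).
  apply/funext => h /=; congr (_ *: (f _ - f _)).
    by rewrite [h *: 1]mulr1 addr0 addrC.
  by rewrite scale0r addr0.
by move: df; rewrite /derivable /derive E => df; split; rewrite /derivable /derive.
Qed.

Lemma continuous_coord (c : 'I_n) : continuous (fun y : 'rV[R]_n => y ord0 c).
Proof. exact: coord_continuous. Qed.

Lemma continuous_sqr_len : continuous (fun y : 'rV[R]_n => len y ^+ 2).
Proof.
under eq_fun do rewrite sqr_len.
apply: continuous_big => [x|i _ x]; first exact: add_continuous.
apply: (@continuous_comp _ _ _ (fun y : 'rV[R]_n => y ord0 i) (fun t => t ^+ 2)).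
  exact: continuous_coord.
exact: exprn_continuous.
Qed.

Lemma continuous_len : continuous (@len R n).
Proof.
have -> : @len R n = (fun y => Num.sqrt (len y ^+ 2)).
  by apply/funext => y; rewrite sqrtr_sqr ger0_norm ?len_ge0.
move=> x; apply: (@continuous_comp _ _ _ (fun y : 'rV[R]_n => len y ^+ 2)).
  exact: continuous_sqr_len.
exact: sqrt_continuous.
Qed.

Lemma ell_len x : ell (len x) = 10 - ln (len x ^+ 2) / 2.
Proof.
rewrite /ell; have := len_ge0 x; rewrite le_eqVlt => /predU1P[<-|x0].
  by rewrite expr0n /= ln0 // mul0r.
by rewrite lnXn // mulr2n; congr (_ - _); field.
Qed.

(** Along a line the squared length is a quadratic polynomial, which reduces the
    directional derivatives of radial functions to calculus in one variable. *)
Lemma sqr_len_line x b t :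
  len (x + t *: e b) ^+ 2 = len x ^+ 2 + 2 * x ord0 b * t + t ^+ 2.
Proof.
rewrite (sqr_len x) (sqr_len (x + _)) (bigD1 b) //= [in RHS](bigD1 b) //=.
rewrite !mxE !eqxx /= mulr1.
rewrite (eq_bigr (fun i => x ord0 i ^+ 2)); first by ring.
by move=> i ib; rewrite !mxE eqxx (negPf ib) mulr0 addr0.
Qed.

Lemma is_derive_ell_line x b : 0 < len x ->
  is_derive (0 : R) (1 : R) (fun t : R => ell (len (x + t *: e b)))
    (- (x ord0 b / len x ^+ 2)).
Proof.
move=> x0; have x2 : 0 < len x ^+ 2 by rewrite exprn_gt0.
have -> : (fun t : R => ell (len (x + t *: e b))) =
   (fun t => 10 - ln (len x ^+ 2 + 2 * x ord0 b * t + t ^+ 2) / 2).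
  by apply/funext => t; rewrite ell_len sqr_len_line.
pose q (t : R) := len x ^+ 2 + 2 * x ord0 b * t + t ^+ 2.
have q0 : q 0 = len x ^+ 2 by rewrite /q mulr0 expr0n !addr0.
have dq : is_derive (0 : R) (1 : R) q (2 * x ord0 b).
  by apply: is_derive_eq; rewrite /GRing.scale /=; ring.
have dln : is_derive (q 0) (1 : R) (@ln R) (q 0)^-1.
  by apply: is_derive1_ln; rewrite q0.
have dc := is_derive_comp1 dln dq.
have -> : (fun t => 10 - ln (len x ^+ 2 + 2 * x ord0 b * t + t ^+ 2) / 2) =
  (fun t => 10 - (@ln R \o q) t * 2^-1) by [].
by apply: is_derive_eq; rewrite /GRing.scale /= q0; field; rewrite gt_eqF.
Qed.

Lemma is_derive_radial x (b c : 'I_n) (F : R -> R) (dF : R) : 0 < len x ->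
  is_derive (ell (len x)) (1 : R) F dF ->
  is_derive x (e b) (fun y => y ord0 c * F (ell (len y)))
   (F (ell (len x)) * (c == b)%:R - dF * (x ord0 c * x ord0 b / len x ^+ 2)).
Proof.
move=> x0 dF1; apply: is_derive_of_line.
pose E (t : R) := ell (len (x + t *: e b)).
have E0 : E 0 = ell (len x) by rewrite /E scale0r addr0.
have dE := is_derive_ell_line b x0; rewrite -/E in dE.
rewrite -E0 in dF1.
have dc := is_derive_comp1 dF1 dE.
have -> : (fun s : R => (x + s *: e b) ord0 c * F (ell (len (x + s *: e b)))) =
  (fun s => (x ord0 c + s * (c == b)%:R) * (F \o E) s).
  by apply/funext => s; rewrite !mxE eqxx.
apply: is_derive_eq; rewrite /GRing.scale /= E0; ring.
Qed.

Lemma continuous_ell_len x : 0 < len x ->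
  {for x, continuous (fun y : 'rV[R]_n => ell (len y))}.
Proof.
move=> x0.
have c1 : {for x, continuous (@ln R \o @len R n)}.
  apply: continuous_comp; first exact: continuous_len.
  exact: continuous_ln.
exact: (cvgB (cvg_cst _) c1).
Qed.

Lemma continuous_radial x (b c : 'I_n) (F dF : R -> R) : 0 < len x ->
  {for ell (len x), continuous F} -> {for ell (len x), continuous dF} ->
  {for x, continuous (fun y : 'rV[R]_n => F (ell (len y)) * (c == b)%:R -
     dF (ell (len y)) * (y ord0 c * y ord0 b / len y ^+ 2))}.
Proof.
move=> x0 cF cdF; have cl := continuous_ell_len x0.
have c1 : {for x, continuous (fun y : 'rV[R]_n => F (ell (len y)))}.
  exact: (@continuous_comp _ _ _ (fun y : 'rV[R]_n => ell (len y)) F).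
have c2 : {for x, continuous (fun y : 'rV[R]_n => dF (ell (len y)))}.
  exact: (@continuous_comp _ _ _ (fun y : 'rV[R]_n => ell (len y)) dF).
have l0 : len x ^+ 2 != 0 by rewrite expf_neq0 // gt_eqF.
have c3 : {for x, continuous (fun y : 'rV[R]_n => y ord0 c * y ord0 b)}.
  apply: (@continuousM R _ (fun y : 'rV[R]_n => y ord0 c) (fun y => y ord0 b));
    exact: continuous_coord.
have c3' : {for x, continuous (fun y : 'rV[R]_n => (len y ^+ 2)^-1)}.
  by apply: continuousV => //; exact: continuous_sqr_len.
have c4 : {for x, continuous (fun y : 'rV[R]_n => F (ell (len y)) * (c == b)%:R)}.
  apply: (@continuousM R _ (fun y : 'rV[R]_n => F (ell (len y))) (cst _)) => //.
  exact: cst_continuous.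
have c5 : {for x, continuous (fun y : 'rV[R]_n =>
    dF (ell (len y)) * (y ord0 c * y ord0 b / len y ^+ 2))}.
  apply: (@continuousM R _ (fun y : 'rV[R]_n => dF (ell (len y)))) => //.
  exact: (@continuousM R _ (fun y : 'rV[R]_n => y ord0 c * y ord0 b)).
apply: (@continuousB R _ _ (fun y : 'rV[R]_n => F (ell (len y)) * (c == b)%:R)
   (fun y : 'rV[R]_n => dF (ell (len y)) * (y ord0 c * y ord0 b / len y ^+ 2))) => //.
Qed.

Lemma continuous_radial0 x (c : 'I_n) (F : R -> R) : 0 < len x ->
  {for ell (len x), continuous F} ->
  {for x, continuous (fun y : 'rV[R]_n => y ord0 c * F (ell (len y)))}.
Proof.
move=> x0 cF.
have c1 : {for x, continuous (fun y : 'rV[R]_n => F (ell (len y)))}.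
  apply: (@continuous_comp _ _ _ (fun y : 'rV[R]_n => ell (len y)) F) => //.
  exact: continuous_ell_len.
apply: (@continuousM R _ (fun y : 'rV[R]_n => y ord0 c)) => //.
exact: continuous_coord.
Qed.

End radial_derivative.

(** * Oscillation of radial tensors *)

Section tensor.
Context {R : realType}.
Variable n : nat.
Implicit Types x y z : 'rV[R]_n.

(** The orthogonal projection on the radial direction; it vanishes at the origin
    because 0^-1 = 0. *)
Definition hat (a b : 'I_n) x : R := x ord0 a * x ord0 b / len x ^+ 2.

Lemma hat0 a b x : len x = 0 -> hat a b x = 0.
Proof. by move=> x0; rewrite /hat x0 expr0n invr0 mulr0. Qed.

Lemma unit_le1 x a : 0 < len x -> `|x ord0 a / len x| <= 1.
Proof.
move=> x0; rewrite normrM normfV (gtr0_norm x0) ler_pdivrMr // mul1r.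
exact: le_coord_len.
Qed.

Lemma hat_unit a b x : hat a b x = (x ord0 a / len x) * (x ord0 b / len x).
Proof. by rewrite /hat expr2 invfM mulrACA. Qed.

Lemma hat_le1 a b x : `|hat a b x| <= 1.
Proof.
have := len_ge0 x; rewrite le_eqVlt => /predU1P[x0|x0].
  by rewrite hat0 // normr0.
by rewrite hat_unit normrM -[leRHS]mulr1 ler_pM // unit_le1.
Qed.

(** The indicator of the complement of the origin, in the form of the trace of
    hat. *)
Definition nonzero x : R := len x ^+ 2 / len x ^+ 2.

Lemma sum_hat x : \sum_a hat a a x = nonzero x.
Proof.
by rewrite /nonzero {1}sqr_len mulr_suml; apply: eq_bigr => a _; rewrite /hat expr2.
Qed.

Lemma nonzeroE x : 0 < len x -> nonzero x = 1.
Proof. by move=> x0; rewrite /nonzero divff // expf_neq0 // gt_eqF. Qed.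

Lemma unit_sub y z a t : 0 < len z -> len z <= len y -> len (y - z) <= t ->
  `|y ord0 a / len y - z ord0 a / len z| * len y <= 2 * t.
Proof.
move=> z0 zy yz; have y0 := lt_le_trans z0 zy.
rewrite -{2}(gtr0_norm y0) -normrM.
have -> : (y ord0 a / len y - z ord0 a / len z) * len y =
  (y ord0 a - z ord0 a) - (z ord0 a / len z) * (len y - len z).
  by field; rewrite !gt_eqF.
rewrite mulrDl mul1r; apply: (le_trans (ler_normB _ _)); apply: lerD.
  by apply: le_trans yz; have := le_coord_len (y - z) a; rewrite !mxE.
rewrite normrM -[leRHS]mul1r ler_pM // ?unit_le1 //.
rewrite ger0_norm ?subr_ge0 //; apply: le_trans yz.
by rewrite lerBlDl len_dist.
Qed.

Lemma hat_sub y z a b t : 0 < len z -> len z <= len y -> len (y - z) <= t ->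
  `|hat a b y - hat a b z| * len y <= 4 * t.
Proof.
move=> z0 zy yz; have y0 := lt_le_trans z0 zy.
have ha := unit_sub a z0 zy yz; have hb := unit_sub b z0 zy yz.
rewrite !hat_unit.
set ya := y ord0 a / _ in ha *; set za := z ord0 a / _ in ha *.
set yb := y ord0 b / _ in hb *; set zb := z ord0 b / _ in hb *.
have -> : ya * yb - za * zb = ya * (yb - zb) + (ya - za) * zb by ring.
have -> : 4 * t = 2 * t + 2 * t by ring.
apply: (@le_trans _ _ (`|yb - zb| * len y + `|ya - za| * len y)); last exact: lerD.
rewrite -mulrDl ler_wpM2r ?len_ge0 //.
apply: (le_trans (ler_normD _ _)); rewrite (normrM ya) (normrM (ya - za)); apply: lerD.
  by rewrite -[leRHS]mul1r ler_wpM2r //; exact: (unit_le1 a y0).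
by rewrite -[leRHS]mulr1 ler_wpM2l //; exact: (unit_le1 b z0).
Qed.

Section far.
Variables (m : R -> R).
Hypothesis hm : submodulus m.

Lemma tensor_le a b x t k : 0 < t -> t <= 4 -> len x <= 4 -> 1 <= k ->
  len x <= k * t -> `|m (len x) * hat a b x| <= k * m t.
Proof.
move=> t0 t4 x4 k1 xk; have mt := submodulus_ge0 hm t0 t4.
have := len_ge0 x; rewrite le_eqVlt => /predU1P[x0|x0].
  rewrite hat0 // mulr0 normr0 mulr_ge0 //; lra.
have mx := submodulus_ge0 hm x0 x4.
rewrite normrM (ger0_norm mx); apply: (@le_trans _ _ (m (len x))).
  by rewrite -[leRHS]mulr1 ler_wpM2l // hat_le1.
exact: (submodulus_scale hm).
Qed.

(** Within distance 4 t of the origin each of the two values is small; farther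
    away the directions of y and z differ by O(t / |y|), and m (|y|) t / |y| is
    at most m t. *)
Lemma tensor_osc a b y z t : 0 < t -> t <= 4 -> len y <= 4 -> len z <= 4 ->
  len (y - z) <= 2 * t ->
  `|m (len y) * hat a b y - m (len z) * hat a b z| <= 10 * m t.
Proof.
move=> t0 t4; have mt := submodulus_ge0 hm t0 t4.
wlog zy : y z / len z <= len y.
  move=> wl y4 z4 yz; have [zy|/ltW yz'] := leP (len z) (len y); first exact: wl.
  by rewrite distrC; apply: wl; rewrite // lenC.
move=> y4 z4 yz; have [yt|yt] := leP (len y) (4 * t).
  apply: (le_trans (ler_normB _ _)).
  apply: (@le_trans _ _ (4 * m t + 4 * m t)); last by lra.
  by apply: lerD; apply: tensor_le => //; [lra|lra|exact: le_trans yt].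
have yzl : len y <= len z + 2 * t by apply: le_trans (len_dist y z) _; rewrite lerD2l.
have z0 : 0 < len z by lra.
have tz : t <= len z by lra.
have [_ mtz mzt] := hm t0 tz z4; have mz : 0 <= m (len z) by exact: le_trans mtz.
have h1 := submodulus_sub hm z0 zy y4.
have h2 := hat_sub a b z0 zy yz.
have -> : m (len y) * hat a b y - m (len z) * hat a b z =
  (m (len y) - m (len z)) * hat a b y + m (len z) * (hat a b y - hat a b z) by ring.
rewrite -(ler_pM2r z0); apply: (@le_trans _ _ (m (len z) * (2 * t) + m (len z) * (4 * (2 * t)))).
  apply: (@le_trans _ _ (`|m (len y) - m (len z)| * len z +
                         m (len z) * (`|hat a b y - hat a b z| * len z))).
    rewrite [m (len z) * (_ * len z)]mulrA -mulrDl ler_wpM2r ?len_ge0 //.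
    apply: (le_trans (ler_normD _ _)).
    rewrite (normrM (m (len y) - m (len z))) (normrM (m (len z))); apply: lerD.
      by rewrite -[leRHS]mulr1 ler_wpM2l // hat_le1.
    by rewrite (ger0_norm mz).
  apply: lerD.
    by apply: (le_trans h1); rewrite ler_wpM2l //; lra.
  rewrite ler_wpM2l //; apply: le_trans h2.
  by rewrite ler_wpM2l.
by move: mzt; lra.
Qed.

End far.

(** Logarithmic growth makes the oscillation of rprof, far from the origin, of the
    order of rslope at the scale of the ball. *)
Lemma rprof_osc_far (g : R) y z t : 0 < g -> g <= 2^-1 -> 0 < t ->
  len y <= 4 -> len z <= 4 -> 2 * t <= len y -> 2 * t <= len z ->
  len (y - z) <= 2 * t -> `|rprof g (len y) - rprof g (len z)| <= 4 * rslope g t.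
Proof.
move=> g0 g2 t0; wlog zy : y z / len z <= len y.
  move=> wl y4 z4 ty tz yz; have [zy|/ltW yz'] := leP (len z) (len y); first exact: wl.
  by rewrite distrC; apply: wl; rewrite // lenC.
move=> y4 z4 ty tz yz.
have z0 : 0 < len z by lra.
have y0 := lt_le_trans z0 zy.
have yzl : len y <= len z + 2 * t by apply: le_trans (len_dist y z) _; rewrite lerD2l.
rewrite distrC; apply: (le_trans (rprof_sub g0 g2 z0 zy y4)).
have hP := submodulus_rslope g0 g2.
have [a b c] := hP _ _ z0 zy y4.
have [a' b' c'] : [/\ 0 <= rslope g t, rslope g t <= rslope g (len z) & rslope g (len z) * t <= rslope g t * len z].
  by apply: hP => //; lra.
have l1 : ln (len y / len z) <= 2 * t / len z.
  apply: (le_trans (ln_le_sub1 (divr_gt0 y0 z0))).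
  rewrite lerBlDr -[X in _ + X](divff (lt0r_neq0 z0)) -mulrDl ler_wpM2r //.
    by rewrite invr_ge0 ltW.
  by rewrite addrC.
have p0 : 0 <= rslope g (len y) by exact: le_trans b.
apply: (le_trans (ler_wpM2l p0 l1)).
rewrite mulrA ler_pdivrMr //.
have h : rslope g (len y) <= 2 * rslope g (len z).
  rewrite -(ler_pM2r z0); apply: (le_trans c).
  apply: (@le_trans _ _ (rslope g (len z) * (2 * len z))); last by lra.
  by rewrite ler_wpM2l //; lra.
have := ler_wpM2r (ltW t0) h; lra.
Qed.

End tensor.

(** * Mean oscillation *)

Section mean_osc.
Context {R : realType}.
Variable n : nat.
Local Notation mu := (@lebesgue_rV R n).
Variable E : set 'rV[R]_n.
Hypotheses (mE : measurable E) (Efin : (mu E < +oo)%E) (E0 : 0 < fine (mu E)).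
Local Notation v := (fine (mu E)).

Let vE : v%:E = mu E. Proof. by rewrite fineK // ge0_fin_numE. Qed.

Let E0e : (0 <= v^-1%:E)%E.
Proof. by rewrite lee_fin invr_ge0 ltW. Qed.

Lemma integrable_near_cst (f : 'rV[R]_n -> R) (c d : R) : measurable_fun E f ->
  (forall y, E y -> `|f y - c| <= d) -> mu.-integrable E (EFin \o f).
Proof.
move=> mf fc; apply: measurable_bounded_integrable => //.
exists (`|c| + d); split; first exact: num_real.
move=> M cM y Ey; apply: (le_trans _ (ltW cM)).
rewrite -(subrK c (f y)) addrC; apply: (le_trans (ler_normD _ _)).
by rewrite lerD2l fc.
Qed.

Lemma integrable_cstR (c : R) : mu.-integrable E (EFin \o cst c).
Proof.
apply: (@integrable_near_cst (cst c) c 0); first exact: measurable_cst.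
by move=> y _ /=; rewrite subrr normr0.
Qed.

Lemma integrable_dist (f : 'rV[R]_n -> R) (c : R) :
  mu.-integrable E (EFin \o f) -> mu.-integrable E (EFin \o (fun y => `|f y - c|)).
Proof.
move=> fi; have := integrable_abse (integrableB mE fi (integrable_cstR c)).
by apply: eq_integrable.
Qed.

Lemma mean_dist (f : 'rV[R]_n -> R) (c d : R) : mu.-integrable E (EFin \o f) ->
  (\int[mu]_(y in E) `|f y - c|%:E <= (d * v)%:E)%E -> `|mean E f - c| <= d.
Proof.
move=> fi fd; have ci := integrable_cstR c.
have -> : mean E f - c = v^-1 * \int[mu]_(y in E) (f y - c).
  rewrite RintegralB // Rintegral_cst // mulrBr; congr (_ - _).
  by rewrite mulrC mulfK // gt_eqF.
rewrite normrM gtr0_norm ?invr_gt0 // ler_pdivrMl // mulrC.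
apply: le_trans (le_normr_Rintegral mE _) _.
  by have := integrableB mE fi ci; apply: eq_integrable.
rewrite -lee_fin; apply: le_trans fd.
rewrite /Rintegral fineK //.
exact: (integrable_fin_num mE (integrable_dist c fi)).
Qed.

(** The mean of a component is within d of each of its values. *)
Lemma mean_osc_le_sup (K : finType) (f : 'rV[R]_n -> K -> R) (p : nat) (d : R) :
  (forall k, measurable_fun E (f^~ k)) ->
  (forall k y z, E y -> E z -> `|f y k - f z k| <= d) ->
  (mean_osc p E f <= ((#|K|%:R * d) ^+ p)%:E)%E.
Proof.
move=> mf fd; have fi k y : E y -> mu.-integrable E (EFin \o f^~ k).
  by move=> Ey; apply: (@integrable_near_cst _ (f y k) d) => // z Ez; exact: fd.
have fm k y : E y -> `|f y k - mean E (f^~ k)| <= d.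
  move=> Ey; rewrite distrC; apply: mean_dist; first exact: fi Ey.
  apply: (@le_trans _ _ (\int[mu]_(z in E) (cst d%:E z))%E).
    apply: le_integral_nomeas => z Ez; rewrite lee_fin //.
    by apply: fd.
  by rewrite integral_cst // EFinM vE.
rewrite /mean_osc; set c := _ ^+ p.
apply: (@le_trans _ _ (v^-1%:E * \int[mu]_(y in E) (cst c%:E y))%E).
  apply: lee_wpmul2l => //.
  apply: le_integral_nomeas => y Ey; rewrite lee_fin.
    by rewrite exprn_ge0 // enorm_ge0.
  have h := enorm_le_card (fm ^~ y ^~ Ey).
  rewrite lerXn2r ?nnegrE ?enorm_ge0 //.
  exact: le_trans (enorm_ge0 _) h.
by rewrite integral_cst // -[X in (_ * (_ * X))%E]vE -!EFinM mulrC mulfK // gt_eqF.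
Qed.

(** The mean is, up to a factor 2, the constant that is closest in mean. *)
Lemma mean_osc1_le (K : finType) (f : 'rV[R]_n -> K -> R) (c : K -> R) (d : R) :
  (forall k, mu.-integrable E (EFin \o f^~ k)) ->
  (forall k, (\int[mu]_(y in E) `|f y k - c k|%:E <= (d * v)%:E)%E) ->
  (mean_osc 1 E f <= (2 * #|K|%:R * d)%:E)%E.
Proof.
move=> fi fd.
have fm k : `|mean E (f^~ k) - c k| <= d by exact: mean_dist (fi k) (fd k).
pose h k y : R := `|f y k - c k| + d.
have d0 (k : K) : 0 <= d by exact: le_trans (normr_ge0 _) (fm k).
have h0 k y : 0 <= h k y by rewrite addr_ge0 // d0.
have hi k : mu.-integrable E (EFin \o h k).
  have := integrableD mE (integrable_dist (c k) (fi k)) (integrable_cstR d).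
  by apply: eq_integrable.
apply: (@le_trans _ _ (v^-1%:E * \int[mu]_(y in E) (\sum_k (h k y)%:E))%E).
  apply: lee_wpmul2l => //.
  apply: le_integral_nomeas => y Ey; first by rewrite lee_fin expr1 enorm_ge0.
  rewrite expr1 sumEFin lee_fin.
  apply: (le_trans (enorm_le_sum _)); apply: ler_sum => k _.
  rewrite (_ : f y k - _ = (f y k - c k) - (mean E (f^~ k) - c k)); last by ring.
  by apply: (le_trans (ler_normB _ _)); rewrite lerD2l.
rewrite ge0_integral_sum //; last 2 first.
- by move=> k; case/integrableP: (hi k).
- by move=> k y _; rewrite lee_fin.
apply: (@le_trans _ _ (v^-1%:E * \sum_(k : K) (2 * d * v)%:E)%E).
  apply: lee_wpmul2l => //; apply: lee_sum => k _.
  rewrite (eq_integral (fun y => (`|f y k - c k|)%:E + (cst d%:E y))%E) //.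
  rewrite ge0_integralD //; first last.
  - by move=> y _; rewrite lee_fin (d0 k).
  - by case/integrableP: (integrable_dist (c k) (fi k)).
  rewrite integral_cst //.
  have -> : 2 * d * v = d * v + d * v by ring.
  by rewrite EFinD [X in (_ <= _ + X)%E]EFinM vE leeD2r.
rewrite sumEFin sumr_const -EFinM lee_fin.
have -> : v^-1 * (2 * d * v *+ #|K|) = 2 * #|K|%:R * d.
  by rewrite -mulr_natl; field; rewrite gt_eqF.
by [].
Qed.

End mean_osc.

(** * Integrability of the logarithm *)

Section log_integral.
Context {R : realType}.
Variable n : nat.
Hypothesis n0 : (0 < n)%N.
Local Notation mu := (@lebesgue_rV R n).
Variable r : R.
Hypothesis r0 : 0 < r.

Let Q (k : nat) := cube (0 : 'rV[R]_n) (r / 2 ^+ k).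

Let ln2_le1 : ln 2 <= 1 :> R.
Proof. by apply: (le_trans (ln_le_sub1 _)) => //; rewrite lerBlDr. Qed.

(** The logarithm counts the dyadic cubes that contain the point. *)
Lemma ln_le_count (y : 'rV[R]_n) :
  ((ln (r / len y))%:E <= \sum_(0 <= k <oo) (\1_(Q k) y)%:E)%E.
Proof.
have s0 : (0 <= \sum_(0 <= k <oo) (\1_(Q k) y)%:E :> \bar R)%E.
  by apply: nneseries_ge0 => k _ _; rewrite lee_fin.
have := len_ge0 y; rewrite le_eqVlt => /predU1P[<-|y0].
  by rewrite invr0 mulr0 ln0.
pose p := fun N => r / len y <= 2 ^+ N.
have exN : exists N, p N.
  exists (Num.bound (r / len y)); rewrite /p.
  have ry : 0 <= r / len y by rewrite divr_ge0 // ltW.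
  apply: (le_trans (ltW (archi_boundP ry))).
  by rewrite -natrX ler_nat ltnW // ltn_expl.
case: (ex_minnP exN) => N pN Nmin.
apply: (@le_trans _ _ (\sum_(0 <= k < N) (\1_(Q k) y)%:E)%E); last first.
  by apply: nneseries_lim_ge => k _ _; rewrite lee_fin.
rewrite (eq_big_nat _ _ (F2 := fun=> 1%:E)); last first.
  move=> k /andP[_ kN]; rewrite indicE mem_set // => i.
  rewrite mxE subr0; apply: (le_trans (le_coord_len y i)).
  rewrite ler_pdivlMr ?exprn_gt0 // mulrC -ler_pdivlMr //.
  by rewrite leNgt; apply/negP => /ltW /Nmin; rewrite leqNgt kN.
rewrite sumEFin big_const_nat iter_addr_0 subn0 lee_fin.
apply: (@le_trans _ _ (ln (2 ^+ N))).
  by rewrite ler_ln ?posrE ?divr_gt0 ?exprn_gt0.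
by rewrite lnXn // lerMn2r ln2_le1 orbT.
Qed.

(** The volumes of the dyadic cubes are summable. *)
Lemma integral_count :
  (\int[mu]_y (\sum_(0 <= k <oo) (\1_(Q k) y)%:E) <= (2 * (2 * r) ^+ n)%:E)%E.
Proof.
have mQ k : measurable (Q k) by exact: measurable_cube.
rewrite integral_nneseries //; last first.
  by move=> k; apply/measurable_EFinP; exact: measurable_indic.
have c0 : 0 <= 2 * (2 * r) ^+ n by rewrite mulr_ge0 // exprn_ge0 // mulr_ge0 // ltW.
apply: (le_trans _ (epsilon_trick0 xpredT c0)).
apply: lee_nneseries => [k _ _|k _].
  by apply: integral_ge0 => y _; rewrite lee_fin.
have -> : (\int[mu]_y (\1_(Q k) y)%:E)%E = mu (Q k) by rewrite integral_indic // setIT.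
have rk : 0 <= r / 2 ^+ k by rewrite divr_ge0 ?exprn_ge0 // ltW.
rewrite (lebesgue_cube _ rk).
rewrite lee_fin mulrA exprMn exprVn natrX exprS invfM.
have -> : 2 * (2 * r) ^+ n * (2^-1 / 2 ^+ k) = (2 * r) ^+ n / 2 ^+ k.
  by field; rewrite expf_neq0.
rewrite ler_wpM2l ?exprn_ge0 ?mulr_ge0 ?(ltW r0) //.
rewrite lef_pV2 ?posrE ?exprn_gt0 // -exprM ler_eXn2l ?ltr1n //.
by rewrite leq_pmulr.
Qed.

Lemma measurable_ln_len (D : set 'rV[R]_n) :
  measurable_fun D (fun y => ln (r / len y)).
Proof.
apply: measurable_funTS.
rewrite (_ : (fun _ => _) = (fun y => if len y == 0 then 0 else ln r - ln (len y))).
  apply: measurable_fun_ifT => //.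
    apply: measurable_fun_eqr => //; first exact: measurable_len.
  apply: measurable_funB => //; apply: measurableT_comp => //; exact: measurable_len.
apply/funext => y; case: eqVneq => [->|y0]; first by rewrite invr0 mulr0 ln0.
by rewrite ln_div ?posrE // lt_neqAle eq_sym y0 len_ge0.
Qed.

Lemma integral_ln_len (E : set 'rV[R]_n) : measurable E -> E `<=` eball 0 r ->
  (\int[mu]_(y in E) `|ln (r / len y)|%:E <= (2 * (2 * r) ^+ n)%:E)%E.
Proof.
move=> mE Er; apply: le_trans integral_count.
have mQ k : measurable (Q k) by exact: measurable_cube.
apply: (@le_trans _ _ (\int[mu]_(y in E) (\sum_(0 <= k <oo) (\1_(Q k) y)%:E))%E).
  apply: le_integral_nomeas => y Ey; rewrite ?lee_fin //.
  rewrite ger0_norm; first exact: ln_le_count.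
  have := len_ge0 y; rewrite le_eqVlt => /predU1P[<-|y0].
    by rewrite invr0 mulr0 ln0.
  apply: ln_ge0; rewrite ler_pdivlMr // mul1r.
  by have := Er _ Ey; rewrite eball0E => /ltW.
apply: ge0_subset_integral => //.
- apply: ge0_emeasurable_sum => [k x _ _|k _]; first by rewrite lee_fin.
  by apply/measurable_EFinP; exact: measurable_indic.
- by move=> y _; apply: nneseries_ge0 => k _ _; rewrite lee_fin.
Qed.

Lemma integrable_ln_len : mu.-integrable (eball 0 r) (fun y => (ln (r / len y))%:E).
Proof.
apply/integrableP; split; first by apply/measurable_EFinP; exact: measurable_ln_len.
apply: (@le_lt_trans _ _ (2 * (2 * r) ^+ n)%:E); last exact: ltry.
by apply: integral_ln_len => //; exact: measurable_eball.
Qed.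

End log_integral.

(** * The smallness condition on the oscillation modulus *)

Section dini.
Context {R : realType}.
Local Notation leb := (@lebesgue_measure R).

Lemma integral_FTC (K k : R -> R) (a b : R) : 0 < a -> a <= b -> b <= 4 ->
  (forall t : R, 0 < t -> t <= 4 -> is_derive t (1 : R) K (k t)) ->
  (forall t : R, 0 < t -> t <= 4 -> derivable k t 1) ->
  (\int[leb]_(t in `[a, b]) (k t)%:E = (K b - K a)%:E)%E.
Proof.
move=> a0; rewrite le_eqVlt => /predU1P[<- _ _ _|ab b4 dK dk].
  by rewrite set_itv1 integral_set1 subrr.
have dK1 (t : R) : 0 < t -> t <= 4 -> derivable K t 1 by move=> t0 t4; case: (dK _ t0 t4).
have ct (f : R -> R) (t : R) : derivable f t 1 -> {for t, continuous f}.
  by move=> /derivable1_diffP /differentiable_continuous.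
rewrite (@continuous_FTC2 _ k K) ?EFinB //.
- apply: derivable_within_continuous => t; rewrite in_itv /= => /andP[at_ tb].
  by apply: dk; [exact: lt_le_trans at_|exact: le_trans b4].
- split.
  + move=> t; rewrite in_itv /= => /andP[at_ tb].
    by apply: dK1; [exact: lt_trans at_|exact: le_trans (ltW tb) b4].
  + by apply: cvg_at_right_filter; apply: ct; apply: dK1 => //; apply: le_trans (ltW ab) b4.
  + by apply: cvg_at_left_filter; apply: ct; apply: dK1 => //; apply: lt_trans ab.
- move=> t; rewrite in_itv /= => /andP[at_ tb]; rewrite derive1E.
  have := dK t (lt_trans a0 at_) (le_trans (ltW tb) b4).
  by case.
Qed.

Lemma is_derive_ell (t : R) : 0 < t -> is_derive t (1 : R) (@ell R) (- t^-1).
Proof.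
move=> t0; have d := is_derive1_ln t0.
rewrite /ell (_ : (fun r => 10 - ln r) = cst 10 - @ln R) //.
by apply: is_derive_eq; rewrite sub0r.
Qed.

Lemma is_derive_ln_ell (t : R) : 0 < t -> t <= 4 ->
  is_derive t (1 : R) (fun t => ln (ell t)) (- (t * ell t)^-1).
Proof.
move=> t0 t4; have e0 := ell_gt0 t0 t4.
apply: (trigger_derive (is_derive_comp1 (is_derive1_ln e0) (is_derive_ell t0))).
by rewrite mulrN invfM mulrC.
Qed.

Lemma derivable_inv (f : R -> R) (t : R) : f t != 0 -> derivable f t 1 ->
  derivable (fun s => (f s)^-1) t 1.
Proof. by move=> f0 df; exact: derivableV. Qed.

Lemma integral_inv_ell (t k : R) : 0 < t -> t <= 2 ->
  (\int[leb]_(s in `[t, 2%R]) (k * (s * ell s)^-1)%:E =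
   (k * (ln (ell t) - ln (ell 2)))%:E)%E.
Proof.
move=> t0 t2; have FTC := @integral_FTC (fun s => - k * ln (ell s)) (fun s => k * (s * ell s)^-1) t 2.
apply: (etrans (FTC t0 t2 _ _ _)).
- by lra.
- move=> s s0 s4; have d := is_derive_ln_ell s0 s4.
  by apply: is_derive_eq; rewrite /GRing.scale /=; ring.
- move=> s s0 s4; apply: derivableM; first exact: derivable_cst.
  have ne : s * ell s != 0 by rewrite mulf_neq0 // gt_eqF // ell_gt0.
  apply: (@derivable_inv (fun s => s * ell s)); first exact: ne.
  apply: derivableM; [exact: derivable_id|by case: (is_derive_ell s0)].
- by congr EFin; ring.
Qed.

(** The function ell ^ (-1/2). *)
Definition rho (t : R) : R := expR (- 2^-1 * ln (ell t)).

Lemma is_derive_rho (t : R) : 0 < t -> t <= 4 ->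
  is_derive t (1 : R) rho (rho t / (2 * (t * ell t))).
Proof.
move=> t0 t4; have e0 := ell_gt0 t0 t4.
have d := is_derive_ln_ell t0 t4.
have dm : is_derive t (1 : R) (fun t => - 2^-1 * ln (ell t)) (- 2^-1 * - (t * ell t)^-1).
  by apply: is_derive_eq; rewrite /GRing.scale /=; ring.
have H := @is_derive_comp1 R expR (fun t => - 2^-1 * ln (ell t)) t _ _
  (is_derive_expR (- 2^-1 * ln (ell t))) dm.
apply: (@trigger_derive R rho _ _ _ H); rewrite -/(rho t); field.
by rewrite !gt_eqF.
Qed.

Lemma derivable_rho (t : R) : 0 < t -> t <= 4 -> derivable rho t 1.
Proof. by move=> t0 t4; case: (is_derive_rho t0 t4). Qed.

(** The primitive - 2 rho t / t exhibits the integral of rho t / t ^ 2 as being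
    of the order of its value at the lower end. *)
Lemma integral_rho (r : R) : 0 < r -> r <= 2 ->
  (\int[leb]_(t in `[r, 2%R]) (rho t / t ^+ 2)%:E <= (2 * rho r / r)%:E)%E.
Proof.
move=> r0 r2.
pose k (t : R) := rho t * ((t * t)^-1 * (2 - (ell t)^-1)).
apply: (@le_trans _ _ (\int[leb]_(t in `[r, 2%R]) (k t)%:E)%E).
  apply: le_integral_nomeas => t /=; rewrite in_itv /= => /andP[rt t2].
    by rewrite lee_fin divr_ge0 ?expR_ge0 ?sqr_ge0.
  have t0 : 0 < t by exact: lt_le_trans rt.
  have t4 : t <= 4 by lra.
  rewrite lee_fin /k expr2 ler_wpM2l ?expR_ge0 // ler_peMr //.
    by rewrite invr_ge0 mulr_ge0 // ltW.
  have := ell_ge7 t0 t4 => l7.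
  have : (ell t)^-1 <= 1 by rewrite invf_le1; lra.
  by lra.
have FTC := @integral_FTC (fun t => - 2 * (rho t * t^-1)) k r 2 r0 r2.
apply: (@le_trans _ _ (- 2 * (rho 2 * 2^-1) - - 2 * (rho r * r^-1))%:E).
  rewrite le_eqVlt; apply/orP; left; apply/eqP; apply: FTC.
  - by lra.
  - move=> t t0 t4; have d := is_derive_rho t0 t4; have e0 := ell_gt0 t0 t4.
    have t1 : t != 0 by rewrite gt_eqF.
    have di : is_derive t (1 : R) (fun s : R => s^-1) (- t ^- 2).
      apply: (trigger_derive (is_deriveV t1 (is_derive_id t (1 : R)))).
      by rewrite /GRing.scale /= mulr1.
    apply: is_derive_eq; rewrite /GRing.scale /= /k; field.
    by rewrite t1 gt_eqF.
  - move=> t t0 t4; have e0 := ell_gt0 t0 t4.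
    apply: derivableM; first exact: derivable_rho.
    apply: derivableM.
      apply: (@derivable_inv (fun t => t * t)); first by rewrite mulf_neq0 // gt_eqF.
      by apply: derivableM; exact: derivable_id.
    apply: derivableB; first exact: derivable_cst.
    apply: (@derivable_inv (@ell R)); first by rewrite gt_eqF.
    by case: (is_derive_ell t0).
rewrite lee_fin; have h : 0 <= rho 2 * 2^-1 by rewrite mulr_ge0 ?expR_ge0.
lra.
Qed.

Lemma rho_small (e : R) : 0 < e ->
  exists2 d, 0 < d & forall r, 0 < r -> r < d -> r <= 4 -> rho r < e.
Proof.
move=> e0; have [d d0 dP] := ell_large (expR (- 2 * ln e)); exists d => // r r0 rd r4.
rewrite /rho -[ltRHS]lnK ?posrE // ltr_expR.
have := dP _ r0 rd; rewrite -[X in _ < X]lnK ?posrE ?ell_gt0 // ltr_expR.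
lra.
Qed.

Variables (om : R -> \bar R) (C k : R).
Hypotheses (C0 : 0 <= C) (k0 : 0 <= k) (Ck : C * k <= 2^-1).
Hypothesis om_ge0 : forall t, (0 <= om t)%E.
Hypothesis om_le : forall t, 0 < t -> t <= 2 -> (om t <= (k / ell t)%:E)%E.

(** With C k <= 1/2 the exponential factor is at most ell ^ (1/2), and this only
    takes back half of the decay of the modulus k / ell. *)
Lemma dini_integrand (t : R) : 0 < t -> t <= 2 ->
  (om t * ((t ^+ 2)^-1)%:E *
    expeR (C%:E * \int[leb]_(s in `[t, 2%R]) (om s * (s^-1)%:E)) <=
   (k * (rho t / t ^+ 2))%:E)%E.
Proof.
move=> t0 t2; have t4 : t <= 4 by lra.
have e0 := ell_gt0 t0 t4; have l0 := ln_ell_ge0 t0 t4.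
have i1 : (\int[leb]_(s in `[t, 2%R]) (om s * (s^-1)%:E) <= (k * ln (ell t))%:E)%E.
  apply: (@le_trans _ _ (\int[leb]_(s in `[t, 2%R]) (k * (s * ell s)^-1)%:E)%E).
    apply: le_integral_nomeas => s /=; rewrite in_itv /= => /andP[ts s2].
      by rewrite mule_ge0 // lee_fin invr_ge0 (le_trans (ltW t0) ts).
    have s0 : 0 < s by exact: lt_le_trans ts.
    apply: (@le_trans _ _ ((k / ell s)%:E * (s^-1)%:E)%E).
      by apply: lee_wpmul2r; [rewrite lee_fin invr_ge0 ltW|exact: om_le].
    by rewrite -EFinM lee_fin invfM [s^-1 * _]mulrC mulrA.
  rewrite integral_inv_ell // lee_fin ler_wpM2l // gerDl oppr_le0.
  by apply: ln_ell_ge0; rewrite ?ler_nat.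
have i2 : (expeR (C%:E * \int[leb]_(s in `[t, 2%R]) (om s * (s^-1)%:E)) <=
           (expR (2^-1 * ln (ell t)))%:E)%E.
  rewrite -[leRHS]/(expeR (2^-1 * ln (ell t))%:E) lee_expeR.
  apply: (@le_trans _ _ (C%:E * (k * ln (ell t))%:E)%E).
    by apply: lee_wpmul2l; rewrite ?lee_fin.
  by rewrite -EFinM lee_fin mulrA ler_wpM2r.
apply: (@le_trans _ _ (((k / ell t) * (t ^+ 2)^-1)%:E * (expR (2^-1 * ln (ell t)))%:E)%E).
  apply: lee_pmul => //.
  - by rewrite mule_ge0 // lee_fin invr_ge0 sqr_ge0.
  - exact: expeR_ge0.
  - rewrite EFinM; apply: lee_wpmul2r; last exact: om_le.
    by rewrite lee_fin invr_ge0 sqr_ge0.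
rewrite -EFinM lee_fin /rho mulNr expRN.
have -> : k / ell t / t ^+ 2 * expR (2^-1 * ln (ell t)) =
  k * (expR (2^-1 * ln (ell t)) / ell t / t ^+ 2).
  by field; rewrite !gt_eqF.
rewrite ler_wpM2l // ler_wpM2r ?invr_ge0 ?sqr_ge0 //.
set x := expR _; have x0 : 0 < x by exact: expR_gt0.
rewrite -[ell t]lnK ?posrE //.
have -> : ln (ell t) = 2^-1 * ln (ell t) + 2^-1 * ln (ell t) by field.
rewrite expRD -/x invfM mulrA divff ?mul1r //.
by rewrite gt_eqF.
Qed.

Lemma limf_esup_dini :
  limf_esup (fun r : R =>
    (r%:E * \int[leb]_(t in `[r, 2%R])
       (om t * ((t ^+ 2)^-1)%:E *
        expeR (C%:E * \int[leb]_(s in `[t, 2%R]) (om s * (s^-1)%:E))))%E)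
    0^'+ = 0%E.
Proof.
set F := (X in limf_esup X _).
have F0 r : 0 < r -> (0 <= F r)%E.
  move=> r0; rewrite /F mule_ge0 ?lee_fin ?(ltW r0) //.
  apply: integral_ge0 => t /=; rewrite in_itv /= => /andP[rt t2].
  rewrite !mule_ge0 ?expeR_ge0 // lee_fin invr_ge0 sqr_ge0 //.
have F1 r : 0 < r -> r <= 2 -> (F r <= (2 * k * rho r)%:E)%E.
  move=> r0 r2; rewrite /F.
  have -> : 2 * k * rho r = r * (k * (2 * rho r / r)) by field; rewrite gt_eqF.
  rewrite EFinM; apply: lee_wpmul2l; first by rewrite lee_fin ltW.
  apply: (@le_trans _ _ (\int[leb]_(t in `[r, 2%R]) (k%:E * (rho t / t ^+ 2)%:E))%E).
    apply: le_integral_nomeas => t /=; rewrite in_itv /= => /andP[rt t2].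
      by rewrite !mule_ge0 ?expeR_ge0 // lee_fin invr_ge0 sqr_ge0.
    by rewrite -EFinM; apply: dini_integrand => //; exact: lt_le_trans rt.
  rewrite ge0_integralZl //.
  - by rewrite EFinM; apply: lee_wpmul2l; rewrite ?lee_fin //; exact: integral_rho.
  - apply/measurable_EFinP; apply: subspace_continuous_measurable_fun => //.
    apply: derivable_within_continuous => t; rewrite in_itv /= => /andP[rt t2].
    have t0 : 0 < t by exact: lt_le_trans rt.
    apply: derivableM; first by apply: derivable_rho => //; lra.
    apply: (@derivable_inv (fun t => t ^+ 2)); first by rewrite expf_neq0 // gt_eqF.
    exact: exprn_derivable.
  - by move=> t _; rewrite lee_fin divr_ge0 ?expR_ge0 ?sqr_ge0.
apply/eqP; rewrite eq_le; apply/andP; split; last first.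
  apply: le_ereal_inf_tmp => _ [V V0 <-].
  have [/= e e0 eV] := V0.
  have [r /andP[r0 re]] : exists r : R, 0 < r < e by exists (e / 2); apply/andP; split; lra.
  apply: (@le_trans _ _ (F r)); first exact: F0.
  apply: ereal_sup_ubound; exists r => //; apply: eV => //=.
  by rewrite sub0r normrN gtr0_norm.
apply/lee_addgt0Pr => e e0; rewrite add0e.
have k1 : 0 < 2 * k + 1 by rewrite ltr_wpDl // mulr_ge0.
have [d d0 dP] := rho_small (divr_gt0 e0 k1).
pose V := [set r : R | 0 < r < Num.min d 2].
apply: (@le_trans _ _ (ereal_sup (F @` V))).
  apply: ereal_inf_lbound; exists V => //.
  exists (Num.min d 2); first by rewrite /= lt_min d0 ltr0n.
  move=> r /=; rewrite sub0r normrN => h r0; rewrite /V /= r0 /=.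
  by rewrite gtr0_norm in h.
apply: ge_ereal_sup => _ [r /= /andP[r0 rm] <-].
move: rm; rewrite lt_min => /andP[rd r2].
apply: le_trans (F1 r r0 (ltW r2)) _; rewrite lee_fin.
have r4 : r <= 4 by lra.
have := dP r r0 rd r4; rewrite ltr_pdivlMr // => h.
have : 0 <= rho r by exact: expR_ge0.
lra.
Qed.

End dini.

(** * Radial functions of logarithmic growth *)

Section radial_functions.
Context {R : realType}.
Local Notation leb := (@lebesgue_measure R).

Lemma measurable_inv : measurable_fun [set: R] (fun t : R => t^-1).
Proof.
have E : (fun t : R => t^-1) =
    (fun t => if 0 < t then expR (- ln t) else
              if t < 0 then - expR (- ln (- t)) else 0).
  apply/funext => t; case: ltP => [t0|]; first by rewrite expRN lnK ?posrE.
  rewrite le_eqVlt => /predU1P[->|t0]; first by rewrite invr0 ltxx.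
  by rewrite t0 expRN lnK ?posrE ?oppr_gt0 // invrN opprK.
have mN : measurable_fun [set: R] (-%R : R -> R).
  by apply: continuous_measurable_fun; exact: opp_continuous.
have m1 : measurable_fun [set: R] (fun t : R => expR (- ln t)).
  exact: measurableT_comp (@measurable_expR R) (measurableT_comp mN (@measurable_ln R)).
have m2 : measurable_fun [set: R] (fun t : R => - expR (- ln (- t))).
  exact: measurableT_comp mN (measurableT_comp m1 mN).
rewrite E; apply: measurable_fun_ifT => //; first exact: measurable_fun_ltr.
by apply: measurable_fun_ifT => //; exact: measurable_fun_ltr.
Qed.

Lemma measurable_funV d (T : measurableType d) (D : set T) (f : T -> R) :
  measurable_fun D f -> measurable_fun D (fun x => (f x)^-1).
Proof. exact: measurableT_comp measurable_inv. Qed.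

Lemma measurable_ell : measurable_fun [set: R] (@ell R).
Proof. by apply: measurable_funB => //; exact: measurable_ln. Qed.

Variable n : nat.
Local Notation mu := (@lebesgue_rV R n).
Local Notation B4 := (eball (0 : 'rV[R]_n) 4).
Local Notation e i := (delta_mx ord0 i : 'rV[R]_n).
Implicit Types x : 'rV[R]_n.

Lemma measurable_radial (F : R -> R) : measurable_fun setT F ->
  measurable_fun [set: 'rV[R]_n] (fun x => F (len x)).
Proof. by move=> mF; apply: measurableT_comp => //; exact: measurable_len. Qed.

Lemma measurable_radial_ell (F : R -> R) : measurable_fun setT F ->
  measurable_fun [set: 'rV[R]_n] (fun x => F (ell (len x))).
Proof.
move=> mF; apply: (@measurable_radial (F \o @ell R)).
exact: measurableT_comp mF measurable_ell.
Qed.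

Lemma measurable_hat (a b : 'I_n) : measurable_fun [set: 'rV[R]_n] (hat a b).
Proof.
apply: measurable_funM.
  by apply: measurable_funM; exact: measurable_coordR.
by apply: measurable_funV; apply: measurable_funX; exact: measurable_len.
Qed.

Lemma measurable_nonzero : measurable_fun [set: 'rV[R]_n] (@nonzero R n).
Proof.
have -> : @nonzero R n = (fun x => \sum_a hat a a x).
  by apply/funext => x; rewrite sum_hat.
by apply: measurable_sum => a; exact: measurable_hat.
Qed.

Lemma ell_len_ge7 x : B4 x -> 7 <= ell (len x).
Proof.
rewrite eball0E /= => x4; have := len_ge0 x; rewrite le_eqVlt => /predU1P[<-|x0].
  by rewrite /ell ln0 //; lra.
by apply: ell_ge7 => //; exact: ltW.
Qed.

Lemma ell_len_le x : ell (len x) <= 10 + `|ln (4 / len x)|.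
Proof.
have := len_ge0 x; rewrite le_eqVlt => /predU1P[<-|x0].
  by rewrite /ell ln0 // subr0 lerDl.
have l4 : 0 <= ln 4 :> R by apply: ln_ge0; lra.
have := ler_norm (ln (4 / len x)); rewrite {1}ln_div ?posrE // /ell; lra.
Qed.

Lemma integrable_le_ell (f : 'rV[R]_n -> R) (K : R) : (0 < n)%N -> 0 <= K ->
  measurable_fun B4 f -> (forall x, B4 x -> `|f x| <= K * ell (len x)) ->
  mu.-integrable B4 (EFin \o f).
Proof.
move=> n0 K0 mf fK; have m4 : measurable B4 by exact: measurable_eball.
have i10 : mu.-integrable B4 (EFin \o cst (10 : R)).
  by apply: integrable_cstR => //; exact: eball_lty.
have iln := @integrable_ln_len R n n0 4 (ltr0n R 4).
have iE := @integrableZl _ _ _ mu _ m4 K _ (integrableD m4 i10 (integrable_abse iln)).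
apply: (le_integrable m4 _ _ iE); first exact/measurable_EFinP.
move=> x Bx /=; rewrite lee_fin; apply: (le_trans (fK x Bx)).
apply: le_trans (ler_norm _); rewrite ler_wpM2l //.
exact: ell_len_le.
Qed.

(** The candidate weak derivative along b of x_c F (ell (len x)). *)
Definition dradial (F dF : R -> R) (c b : 'I_n) x : R :=
  F (ell (len x)) * (c == b)%:R - dF (ell (len x)) * hat c b x.

Lemma measurable_dradial (F dF : R -> R) c b : measurable_fun setT F ->
  measurable_fun setT dF -> measurable_fun setT (dradial F dF c b).
Proof.
move=> mF mdF; apply: measurable_funB.
  by apply: measurable_funM => //; exact: measurable_radial_ell.
by apply: measurable_funM; [exact: measurable_radial_ell|exact: measurable_hat].
Qed.

Lemma dradial_le (F dF : R -> R) c b x :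
  `|dradial F dF c b x| <= `|F (ell (len x))| + `|dF (ell (len x))|.
Proof.
apply: (le_trans (ler_normB _ _)); apply: lerD; rewrite normrM.
  by rewrite -[leRHS]mulr1 ler_wpM2l //; case: eqP; rewrite ?normr1 ?normr0.
by rewrite -[leRHS]mulr1 ler_wpM2l // hat_le1.
Qed.

Lemma integrable_dradial (F dF : R -> R) K c b : (0 < n)%N -> 0 <= K ->
  measurable_fun setT F -> measurable_fun setT dF ->
  (forall l, 7 <= l -> `|F l| <= K * l) -> (forall l, 7 <= l -> `|dF l| <= K * l) ->
  mu.-integrable B4 (EFin \o dradial F dF c b).
Proof.
move=> n0 K0 mF mdF FK dFK; apply: (@integrable_le_ell _ (2 * K)) => //.
- by rewrite mulr_ge0.
- by apply: measurable_funTS; exact: measurable_dradial.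
- move=> x Bx; apply: (le_trans (dradial_le F dF c b x)).
  have l7 := ell_len_ge7 Bx.
  have -> : 2 * K * ell (len x) = K * ell (len x) + K * ell (len x) by ring.
  by rewrite lerD ?FK ?dFK.
Qed.

Lemma weak_partial_radial (F dF : R -> R) K c b : (2 <= n)%N -> 0 <= K ->
  measurable_fun setT F -> measurable_fun setT dF ->
  (forall l, 7 <= l -> `|F l| <= K * l) -> (forall l, 7 <= l -> `|dF l| <= K * l) ->
  (forall l : R, 0 < l -> is_derive l (1 : R) F (dF l)) ->
  (forall l, 0 < l -> {for l, continuous dF}) ->
  weak_partial B4 b (fun x => x ord0 c * F (ell (len x))) (dradial F dF c b).
Proof.
move=> n2 K0 mF mdF FK dFK dF1 cdF; have n0 : (0 < n)%N by exact: ltnW.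
have lpos x : B4 x -> 0 < ell (len x) by move=> /ell_len_ge7 h; lra.
have cF l : 0 < l -> {for l, continuous F}.
  by move=> /dF1 [d _]; exact/differentiable_continuous/derivable1_diffP.
apply: (weak_partial_punctured n2) => //.
- move=> x Bx /neq0_len_gt0 x0; apply: is_derive_radial => //; apply: dF1; exact: lpos.
- by move=> x Bx /neq0_len_gt0 x0; apply: continuous_radial0 => //; apply: cF; exact: lpos.
- move=> x Bx /neq0_len_gt0 x0; apply: continuous_radial => //.
    by apply: cF; exact: lpos.
  by apply: cdF; exact: lpos.
- apply: (@integrable_le_ell _ (4 * K)) => //.
  + by rewrite mulr_ge0.
  + apply: measurable_funTS; apply: measurable_funM; first exact: measurable_coordR.
    exact: measurable_radial_ell.
  + move=> x Bx; rewrite normrM -mulrA ler_pM // ?FK ?ell_len_ge7 //.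
    apply: (le_trans (le_coord_len x c)); move: Bx; rewrite eball0E /=; exact: ltW.
- exact: (integrable_dradial (K := K)).
Qed.

End radial_functions.

(** * The equation *)

Section profile.
Context {R : realType}.
Variables (g nu : R).
Hypotheses (g0 : 0 < g) (g2 : g <= 2^-1) (nu1 : 1 <= nu).

Definition dprof (l : R) : R := g * (prof g l / l).

(** The stream function phi and its derivative are chosen so that the
    divergence-free field built on phi is the flux of the solution. *)
Definition phi (l : R) : R := (prof g l - dprof l) / nu.
Definition dphi (l : R) : R := (dprof l + (1 - g) * (dprof l / l)) / nu.

(** One minus the tangential eigenvalue of the coefficients. *)
Definition defect (r : R) : R :=
  ((1 + nu^-1) * g) * (ell r)^-1 + (g * (1 - g) / nu) * (ell r)^-1 ^+ 2.

Let g1 : g <= 1. Proof. by move: g2 => h; lra. Qed.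
Let nu0 : 0 < nu. Proof. by move: nu1 => h; lra. Qed.
Let nuV : 0 <= nu^-1 <= 1.
Proof. by rewrite invr_ge0 (ltW nu0) /= invf_le1. Qed.

Lemma is_derive_prof (l : R) : 0 < l -> is_derive l (1 : R) (prof g) (dprof l).
Proof.
move=> l0; have d1 := is_derive1_ln l0.
have d2 : is_derive l (1 : R) (fun l => g * ln l) (g * l^-1).
  by apply: is_derive_eq; rewrite /GRing.scale /=; ring.
have H := @is_derive_comp1 R expR (fun l => g * ln l) l _ _ (is_derive_expR (g * ln l)) d2.
by apply: (@trigger_derive R (prof g) _ _ _ H); rewrite -/(prof g l) /dprof; ring.
Qed.

Let dinv (l : R) : 0 < l -> is_derive l (1 : R) (fun s : R => s^-1) (- l ^- 2).
Proof.
move=> l0; have l1 : l != 0 by rewrite gt_eqF.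
apply: (trigger_derive (is_deriveV l1 (is_derive_id l (1 : R)))).
by rewrite /GRing.scale /= mulr1.
Qed.

Lemma is_derive_dprof (l : R) : 0 < l ->
  is_derive l (1 : R) dprof ((g - 1) * (dprof l / l)).
Proof.
move=> l0; have d1 := is_derive_prof l0; have d2 := dinv l0.
by apply: is_derive_eq; rewrite /GRing.scale /= /dprof; field; rewrite gt_eqF.
Qed.

Lemma is_derive_phi (l : R) : 0 < l -> is_derive l (1 : R) phi (dphi l).
Proof.
move=> l0; have d1 := is_derive_prof l0; have d2 := is_derive_dprof l0.
by apply: is_derive_eq; rewrite /GRing.scale /= /dphi; field; rewrite !gt_eqF.
Qed.

Let cder (f : R -> R) (l a : R) : is_derive l (1 : R) f a -> {for l, continuous f}.
Proof. by move=> [d _]; exact/differentiable_continuous/derivable1_diffP. Qed.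

Lemma continuous_dprof (l : R) : 0 < l -> {for l, continuous dprof}.
Proof. by move=> /is_derive_dprof; exact: cder. Qed.

Lemma continuous_dphi (l : R) : 0 < l -> {for l, continuous dphi}.
Proof.
move=> l0; have d1 := is_derive_dprof l0; have d2 := dinv l0.
have d3 : is_derive l (1 : R) dphi
   (((g - 1) * (dprof l / l) + (1 - g) * ((g - 1) * (dprof l / l) / l - dprof l / l ^+ 2)) / nu).
  by apply: is_derive_eq; rewrite /GRing.scale /=; field; rewrite !gt_eqF.
exact: cder d3.
Qed.

Lemma measurable_prof : measurable_fun setT (prof g).
Proof.
apply: measurableT_comp => //.
by apply: measurable_funM => //; exact: measurable_ln.
Qed.

Lemma measurable_dprof : measurable_fun setT dprof.
Proof.
apply: measurable_funM => //; apply: measurable_funM; first exact: measurable_prof.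
exact: measurable_inv.
Qed.

Lemma measurable_phi : measurable_fun setT phi.
Proof.
apply: measurable_funM => //.
by apply: measurable_funB; [exact: measurable_prof|exact: measurable_dprof].
Qed.

Lemma measurable_dphi : measurable_fun setT dphi.
Proof.
apply: measurable_funM => //; apply: measurable_funD; first exact: measurable_dprof.
apply: measurable_funM => //; apply: measurable_funM; first exact: measurable_dprof.
exact: measurable_inv.
Qed.

Lemma measurable_defect : measurable_fun setT defect.
Proof.
have mi : measurable_fun setT (fun r => (@ell R r)^-1).
  exact: measurable_funV (@measurable_ell R).
by apply: measurable_funD; apply: measurable_funM => //; apply: measurable_funX.
Qed.

Lemma prof_gt0 (l : R) : 0 < prof g l. Proof. exact: expR_gt0. Qed.

Lemma sqr_prof_le (l : R) : 7 <= l -> prof g l ^+ 2 <= l.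
Proof.
move=> l7; have l0 : 0 < l by lra.
have h : 0 <= ln l by apply: ln_ge0; lra.
rewrite /prof expr2 -expRD -[leRHS]lnK ?posrE // ler_expR.
have : 0 <= 1 - 2 * g by move: g2 => ?; lra.
by move=> /mulr_ge0 /(_ h); lra.
Qed.

Lemma prof_le (l : R) : 7 <= l -> prof g l <= l.
Proof.
move=> l7; have := sqr_prof_le l7; have := prof_gt0 l.
by move=> h1 h2; rewrite leNgt; apply/negP => h; nra.
Qed.

Lemma dprof_itv (l : R) : 7 <= l -> 0 <= dprof l <= 2^-1.
Proof.
move=> l7; have l0 : 0 < l by lra.
have h : prof g l / l <= 1 by rewrite ler_pdivrMr // mul1r prof_le.
have h0 : 0 <= prof g l / l by rewrite divr_ge0 ?ltW ?prof_gt0.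
apply/andP; split; first by rewrite mulr_ge0 // ltW.
by rewrite /dprof -[leRHS]mulr1 ler_pM // ltW.
Qed.

Lemma prof_bound (l : R) : 7 <= l -> `|prof g l| <= 2 * l.
Proof. by move=> l7; rewrite gtr0_norm ?prof_gt0 //; have := prof_le l7; lra. Qed.

Lemma dprof_bound (l : R) : 7 <= l -> `|dprof l| <= 2 * l.
Proof.
by move=> l7; have /andP[h1 h2] := dprof_itv l7; rewrite ger0_norm //; lra.
Qed.

Lemma phi_bound (l : R) : 7 <= l -> `|phi l| <= 2 * l.
Proof.
move=> l7; have /andP[h1 h2] := dprof_itv l7; have h3 := prof_le l7.
have h4 := prof_gt0 l; have /andP[n1 n2] := nuV.
rewrite normrM (ger0_norm n1) -[leRHS]mulr1 ler_pM //.
by rewrite ler_norml; apply/andP; split; lra.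
Qed.

Lemma dphi_bound (l : R) : 7 <= l -> `|dphi l| <= 2 * l.
Proof.
move=> l7; have l0 : 0 < l by lra.
have /andP[h1 h2] := dprof_itv l7; have /andP[n1 n2] := nuV.
have h3 : dprof l / l <= 1 by rewrite ler_pdivrMr // mul1r; lra.
have h4 : 0 <= dprof l / l by rewrite divr_ge0 // ltW.
have h5 : 0 <= 1 - g by rewrite subr_ge0.
have h6 : (1 - g) * (dprof l / l) <= 1.
  by rewrite -[leRHS]mulr1 ler_pM //; move: g0 => ?; lra.
have h7 : 0 <= (1 - g) * (dprof l / l) by exact: mulr_ge0.
rewrite normrM (ger0_norm n1) -[leRHS]mulr1 ler_pM //.
by rewrite ger0_norm; lra.
Qed.

Lemma submodulus_defect : submodulus defect.
Proof.
have /andP[n1 n2] := nuV.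
apply: submodulusD.
  apply: submodulusZ (@submodulus_inv_ell R).
  by rewrite mulr_ge0 ?addr_ge0 // ltW.
apply: submodulusZ (@submodulus_inv_ell2 R).
by rewrite mulr_ge0 // mulr_ge0 ?subr_ge0 // ltW.
Qed.

Lemma defect_itv_ell (r : R) : 7 <= ell r -> 0 <= defect r <= 3 * g / ell r.
Proof.
move=> l7; have l0 : 0 < ell r by lra.
have /andP[n1 n2] := nuV; have p0 : 0 <= (ell r)^-1 by rewrite invr_ge0 ltW.
have p1 : (ell r)^-1 <= 1 by rewrite invf_le1 //; lra.
have h5 : 0 <= 1 - g by rewrite subr_ge0.
have a0 : 0 <= (1 + nu^-1) * g by rewrite mulr_ge0 ?addr_ge0 // ltW.
have b0 : 0 <= g * (1 - g) / nu by rewrite mulr_ge0 // mulr_ge0 // ltW.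
apply/andP; split.
  by rewrite /defect addr_ge0 // mulr_ge0 // sqr_ge0.
have h1 : (1 + nu^-1) * g <= 2 * g by rewrite ler_wpM2r ?(ltW g0) //; lra.
have h2 : g * (1 - g) / nu <= g.
  rewrite -mulrA -[leRHS]mulr1 ler_wpM2l ?(ltW g0) //.
  by rewrite -[leRHS]mulr1 ler_pM //; move: g0 => ?; lra.
have h3 : (ell r)^-1 ^+ 2 <= (ell r)^-1 by rewrite expr2 ler_piMl.
rewrite /defect.
apply: (@le_trans _ _ (2 * g * (ell r)^-1 + g * (ell r)^-1)); last by lra.
by apply: lerD; [rewrite ler_wpM2r|rewrite ler_pM ?sqr_ge0].
Qed.

Lemma defect_itv (r : R) : 7 <= ell r -> 0 <= defect r <= 2^-1.
Proof.
move=> l7; have /andP[h1 h2] := defect_itv_ell l7; rewrite h1 /=.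
apply: (le_trans h2); rewrite ler_pdivrMr; last by lra.
by move: g2 => ?; lra.
Qed.

Lemma defect_prof (r : R) : 0 < ell r ->
  defect r * prof g (ell r) = dprof (ell r) + dphi (ell r).
Proof.
by move=> l0; rewrite /defect /dphi /dprof; field; rewrite !gt_eqF.
Qed.

End profile.

Section equation.
Context {R : realType}.
Variables (n N : nat) (o : 'I_n) (g : R).
Hypotheses (n2 : (2 <= n)%N) (g0 : 0 < g) (g2 : g <= 2^-1).
Local Notation mu := (@lebesgue_rV R n).
Local Notation B4 := (eball (0 : 'rV[R]_n) 4).
Implicit Types x : 'rV[R]_n.

Local Notation nu := (n.-1%:R : R).
Let nu1 : 1 <= nu.
Proof. by rewrite ler1n; case: n n2 => [|[]]. Qed.
Let n0 : (0 < n)%N. Proof. exact: ltnW. Qed.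

(** The scalar coefficients have eigenvalue 1 in the radial direction and
    1 - defect in the tangential ones. *)
Definition acoef (a b : 'I_n) x : R :=
  (a == b)%:R - defect g nu (len x) * ((a == b)%:R * nonzero x - hat a b x).

Definition coef x (k : 'I_N * 'I_N * 'I_n * 'I_n) : R :=
  (k.1.1.1 == k.1.1.2)%:R * acoef k.1.2 k.2 x.

Definition sol x (i : 'I_N) : R := x ord0 o * prof g (ell (len x)).

Definition dsol x (q : 'I_N * 'I_n) : R := dradial (prof g) (dprof g) o q.2 x.

Lemma sum_delta (f : 'I_n -> R) (a : 'I_n) : \sum_b (a == b)%:R * f b = f a.
Proof.
rewrite (bigD1 a) //= eqxx mul1r big1 ?addr0 // => b ba.
by rewrite eq_sym (negPf ba) mul0r.
Qed.

Lemma hatC (a b : 'I_n) x : hat a b x = hat b a x.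
Proof. by rewrite /hat [x ord0 a * _]mulrC. Qed.

Lemma sum_hat_hat (a b : 'I_n) x : \sum_c hat a c x * hat b c x = hat a b x.
Proof.
have := len_ge0 x; rewrite le_eqVlt => /predU1P[x0|x0].
  by rewrite hat0 // big1 // => c _; rewrite hat0 // mul0r.
rewrite (eq_bigr (fun c => hat a b x * hat c c x)); last first.
  by move=> c _; rewrite /hat; field; rewrite gt_eqF.
by rewrite -mulr_sumr sum_hat nonzeroE // mulr1.
Qed.

(** In the tangential part, defect_prof turns the loss defect * prof of the flux
    into dprof + dphi. *)
Lemma flux_eq x (a : 'I_n) : 0 < len x -> 0 < ell (len x) ->
  \sum_b acoef a b x * dradial (prof g) (dprof g) o b x =
  (nu * phi g nu (ell (len x)) - dphi g nu (ell (len x))) * (o == a)%:R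
  + dphi g nu (ell (len x)) * hat o a x.
Proof.
move=> x0 l0; rewrite /acoef /dradial nonzeroE //.
set l := ell (len x); set m := defect g nu (len x).
have Em : m * prof g l = dprof g l + dphi g nu l.
  by apply: defect_prof => //; move: nu1 => ?; lra.
rewrite (eq_bigr (fun b => (1 - m) * ((a == b)%:R *
     (prof g l * (o == b)%:R - dprof g l * hat o b x)) +
   (m * prof g l * ((o == b)%:R * hat a b x) -
    m * dprof g l * (hat a b x * hat o b x)))); last by move=> b _; ring.
rewrite big_split sumrB /= -!mulr_sumr !sum_delta sum_hat_hat (hatC a o).
have -> : nu * phi g nu l = prof g l - dprof g l.
  by rewrite /phi mulrC divfK // gt_eqF //; move: nu1 => ?; lra.
have -> : dphi g nu l = m * prof g l - dprof g l by rewrite Em; ring.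
ring.
Qed.

(** The flux is the divergence of the antisymmetric matrix with entries
    phi (delta_oa x_c - delta_oc x_a). *)
Lemma flux_pairing x (y : 'I_n -> R) : 0 < len x -> 0 < ell (len x) ->
  \sum_a (\sum_b acoef a b x * dradial (prof g) (dprof g) o b x) * y a =
  \sum_c (dradial (phi g nu) (dphi g nu) c c x * y o -
          dradial (phi g nu) (dphi g nu) c o x * y c).
Proof.
move=> x0 l0.
set F := phi g nu (ell (len x)); set dF := dphi g nu (ell (len x)).
rewrite (eq_bigr (fun a => (nu * F - dF) * ((o == a)%:R * y a) + dF * (hat o a x * y a)));
  last by move=> a _; rewrite flux_eq // -/F -/dF; ring.
rewrite big_split /= -!mulr_sumr sum_delta.
rewrite [RHS](eq_bigr (fun c => (F * y o - (dF * y o) * hat c c x) -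
   (F * ((o == c)%:R * y c) - dF * (hat o c x * y c)))); last first.
  by move=> c _; rewrite /dradial eqxx mulr1 -/F -/dF (eq_sym c o) (hatC c o); ring.
rewrite sumrB sumrB sumrB -!mulr_sumr sum_hat nonzeroE // sum_delta.
rewrite sumr_const card_ord -[_ *+ n]mulr_natl.
have -> : n%:R = nu + 1 :> R by rewrite natr1 prednK.
ring.
Qed.

Lemma weak_partial_sol (i : 'I_N) (b : 'I_n) :
  weak_partial B4 b (sol^~ i) (dsol^~ (i, b)).
Proof.
apply: (weak_partial_radial (K := 2)) => //.
- exact: measurable_prof.
- exact: measurable_dprof.
- exact: prof_bound.
- exact: dprof_bound.
- by move=> l l0; exact: is_derive_prof.
- by move=> l l0; exact: continuous_dprof.
Qed.

Lemma weak_partial_phi (c b : 'I_n) :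
  weak_partial B4 b (fun x => x ord0 c * phi g nu (ell (len x)))
    (dradial (phi g nu) (dphi g nu) c b).
Proof.
apply: (weak_partial_radial (K := 2)) => //.
- exact: measurable_phi.
- exact: measurable_dphi.
- exact: phi_bound.
- exact: dphi_bound.
- by move=> l l0; exact: is_derive_phi.
- by move=> l l0; exact: continuous_dphi.
Qed.

End equation.

Section solution.
Context {R : realType}.
Variables (n N : nat) (o : 'I_n) (g : R).
Hypotheses (n2 : (2 <= n)%N) (g0 : 0 < g) (g2 : g <= 2^-1).
Local Notation mu := (@lebesgue_rV R n).
Local Notation B4 := (eball (0 : 'rV[R]_n) 4).
Local Notation nu := (n.-1%:R : R).
Implicit Types x y z : 'rV[R]_n.
Let nu1 : 1 <= nu.
Proof. by rewrite ler1n; case: n n2 => [|[]]. Qed.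
Let n0 : (0 < n)%N. Proof. exact: ltnW. Qed.
Let mB4 : measurable B4. Proof. exact: measurable_eball. Qed.

Lemma measurable_acoef (a b : 'I_n) : measurable_fun setT (acoef g a b).
Proof.
apply: measurable_funB => //; apply: measurable_funM.
  by apply: measurable_radial; exact: measurable_defect.
apply: measurable_funB; last exact: measurable_hat.
by apply: measurable_funM => //; exact: measurable_nonzero.
Qed.

Lemma measurable_coef k : measurable_fun setT (fun x => coef (N := N) g x k).
Proof. by apply: measurable_funM => //; exact: measurable_acoef. Qed.

Lemma measurable_dsol q : measurable_fun setT (fun x => dsol (N := N) o g x q).
Proof. by apply: measurable_dradial; [exact: measurable_prof|exact: measurable_dprof]. Qed.

Lemma measurable_sol i : measurable_fun setT (fun x => sol (N := N) o g x i).
Proof.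
apply: measurable_funM; first exact: measurable_coordR.
by apply: measurable_radial_ell; exact: measurable_prof.
Qed.

(** ** Membership in H^1 *)

Lemma abs_dsol_le x q : B4 x -> `|dsol (N := N) o g x q| <= 2 * prof g (ell (len x)).
Proof.
move=> Bx; have l7 := ell_len_ge7 Bx; have /andP[h1 h2] := dprof_itv g0 g2 l7.
apply: (le_trans (dradial_le _ _ _ _ _)).
rewrite (gtr0_norm (prof_gt0 _ _)) (ger0_norm h1).
have : 1 <= prof g (ell (len x)).
  rewrite /prof -[leLHS]expR0 ler_expR mulr_ge0 ?(ltW g0) // ln_ge0 //; lra.
lra.
Qed.

Lemma integrable_dsol q : mu.-integrable B4 (fun x => (dsol (N := N) o g x q)%:E).
Proof.
apply: (integrable_dradial (K := 2)) => //.
- exact: measurable_prof.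
- exact: measurable_dprof.
- exact: prof_bound.
- exact: dprof_bound.
Qed.

Lemma L2_sol : L2 B4 (sol (N := N) o g).
Proof.
move=> i; split; first by apply: measurable_funTS; exact: measurable_sol.
apply: (@integrable_le_ell _ _ (fun x => sol o g x i ^+ 2) 16) => //.
  by apply: measurable_funX; apply: measurable_funTS; exact: measurable_sol.
move=> x Bx; rewrite /sol exprMn normrM.
have l7 := ell_len_ge7 Bx; have h := sqr_prof_le g2 l7.
apply: ler_pM => //; last by rewrite ger0_norm ?sqr_ge0.
rewrite normrX; have := le_coord_len x o; move: Bx; rewrite eball0E /= => x4 xo.
have h0 := normr_ge0 (x ord0 o); rewrite expr2; nra.
Qed.

Lemma L2_dsol : L2 B4 (dsol (N := N) o g).
Proof.
move=> q; split; first by apply: measurable_funTS; exact: measurable_dsol.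
apply: (@integrable_le_ell _ _ (fun x => dsol o g x q ^+ 2) 4) => //.
  by apply: measurable_funX; apply: measurable_funTS; exact: measurable_dsol.
move=> x Bx; have l7 := ell_len_ge7 Bx; have h := sqr_prof_le g2 l7.
rewrite normrX; have h1 := abs_dsol_le q Bx.
have h0 := normr_ge0 (dsol o g x q).
have h2 := prof_gt0 g (ell (len x)).
move: h h0 h1; set D := `| _ |; rewrite !expr2; nra.
Qed.

Lemma sobolev_sol : sobolev_H1 B4 (sol (N := N) o g) (dsol o g).
Proof.
split; [exact: L2_sol|exact: L2_dsol|].
by move=> i b; exact: weak_partial_sol.
Qed.

(** ** The weak formulation *)

Lemma ae_off_origin (P : 'rV[R]_n -> Prop) :
  (forall x, 0 < len x -> P x) -> {ae mu, forall x, P x}.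
Proof.
move=> h; exists [set 0]; split; [exact: measurable_origin|exact: origin_null|].
move=> x /= nP; apply: contrapT => x0; apply: nP; apply: h.
by apply: neq0_len_gt0; exact/eqP.
Qed.

Lemma integrable_dphi c b :
  mu.-integrable B4 (EFin \o dradial (phi g nu) (dphi g nu) c b).
Proof.
apply: (integrable_dradial (K := 2)) => //.
- exact: measurable_phi.
- exact: measurable_dphi.
- exact: phi_bound.
- exact: dphi_bound.
Qed.

(** Integrating by parts twice leaves an antisymmetric combination of second
    derivatives of the test function. *)
Lemma integral_curl0 (c : 'I_n) (eta : 'rV[R]_n -> R) : test_function B4 eta ->
  (\int[mu]_(x in B4)
    (dradial (phi g nu) (dphi g nu) c c x * partial o eta x -
     dradial (phi g nu) (dphi g nu) c o x * partial c eta x)%:E = 0)%E.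
Proof.
move=> te; have [se _ _] := te.
have to := test_function_partial o te; have tc := test_function_partial c te.
have i1 := integrable_mul_test mB4 to (integrable_dphi c c).
have i2 := integrable_mul_test mB4 tc (integrable_dphi c o).
have w1 := weak_partial_phi n2 g0 g2 c c to.
have w2 := weak_partial_phi n2 g0 g2 c o tc.
have E : (\int[mu]_(x in B4)
    (x ord0 c * phi g nu (ell (len x)) * partial c (partial o eta) x)%:E =
  \int[mu]_(x in B4)
    (x ord0 c * phi g nu (ell (len x)) * partial o (partial c eta) x)%:E)%E.
  by apply: eq_integral => x _; rewrite (partialC c o).
have E2 := oppe_inj (etrans (esym w1) (etrans E w2)).
apply: (etrans (integralB mB4 i1 i2)).
apply: (etrans (congr2 (fun a b => a - b)%E E2 erefl)).
exact: subee (integrable_fin_num mB4 i2).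
Qed.

Lemma integrable_curl (c : 'I_n) (eta : 'rV[R]_n -> R) : test_function B4 eta ->
  mu.-integrable B4 (fun x => 
    (dradial (phi g nu) (dphi g nu) c c x * partial o eta x -
     dradial (phi g nu) (dphi g nu) c o x * partial c eta x)%:E).
Proof.
move=> te.
have to := test_function_partial o te; have tc := test_function_partial c te.
have i1 := integrable_mul_test mB4 to (integrable_dphi c c).
have i2 := integrable_mul_test mB4 tc (integrable_dphi c o).
by have := integrableB mB4 i1 i2; apply: eq_integrable.
Qed.

Lemma weak_solution_sol : weak_solution B4 (coef (N := N) g) (dsol o g).
Proof.
move=> i eta te; have [se _ _] := te.
pose f c x := dradial (phi g nu) (dphi g nu) c c x * partial o eta x -
     dradial (phi g nu) (dphi g nu) c o x * partial c eta x.
have fi c : mu.-integrable B4 (EFin \o f c) by exact: integrable_curl.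
have f0 : (\int[mu]_(x in B4) (\sum_c (f c x)%:E) = 0)%E.
  by rewrite integral_sum // big1 // => c _; exact: integral_curl0.
rewrite -[RHS]f0; apply: ae_eq_integral => //.
- apply/measurable_EFinP.
  apply: measurable_sum => a; apply: measurable_sum => b; apply: measurable_sum => j.
  apply: measurable_funTS; apply: measurable_funM.
    by apply: measurable_funM; [exact: measurable_coef|exact: measurable_dsol].
  by apply: test_function_measurable (test_function_partial a te).
- by apply: emeasurable_sum => c; case/integrableP: (fi c).
- apply: ae_off_origin => x x0 Bx; rewrite sumEFin; congr EFin.
  have l0 : 0 < ell (len x) by have := ell_len_ge7 Bx; lra.
  rewrite -flux_pairing //; apply: eq_bigr => a _; rewrite mulr_suml.
  apply: eq_bigr => b _; rewrite (bigD1 i) //= big1 ?addr0.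
    by rewrite /coef /dsol /= eqxx mul1r.
  by move=> j ji; rewrite /coef /= eq_sym (negPf ji) !mul0r.
Qed.

End solution.

(** * The coefficients *)

Section coefficients.
Context {R : realType}.
Variables (n N : nat) (g : R).
Hypotheses (n2 : (2 <= n)%N) (g0 : 0 < g) (g2 : g <= 2^-1).
Local Notation mu := (@lebesgue_rV R n).
Local Notation B4 := (eball (0 : 'rV[R]_n) 4).
Local Notation nu := (n.-1%:R : R).
Local Notation K := ('I_N * 'I_N * 'I_n * 'I_n)%type.
Implicit Types x y z : 'rV[R]_n.
Let nu1 : 1 <= nu.
Proof. by rewrite ler1n; case: n n2 => [|[]]. Qed.
Let n0 : (0 < n)%N. Proof. exact: ltnW. Qed.

Lemma nonzero_itv x : 0 <= nonzero x <= 1.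
Proof.
have := len_ge0 x; rewrite le_eqVlt => /predU1P[x0|x0].
  by rewrite /nonzero -x0 expr0n mul0r lexx ler01.
by rewrite nonzeroE // ler01 lexx.
Qed.

Lemma coef_le2 x k : B4 x -> `|coef (N := N) g x k| <= 2.
Proof.
move=> Bx; have /andP[m0 m2] := defect_itv g0 g2 nu1 (ell_len_ge7 Bx).
rewrite normrM -[leRHS]mul1r; apply: ler_pM => //.
  by case: eqP; rewrite ?normr1 ?normr0.
have -> : 2 = 1 + 2^-1 * (1 + 1) :> R by field.
have b1 (b : bool) : `|b%:R : R| <= 1 by case: b; rewrite ?normr1 ?normr0.
apply: (le_trans (ler_normB _ _)); apply: lerD; first exact: b1.
rewrite normrM (ger0_norm m0); apply: ler_pM => //.
apply: (le_trans (ler_normB _ _)); apply: lerD; last exact: hat_le1.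
rewrite normrM -[leRHS]mulr1; apply: ler_pM => //.
by have /andP[h1 h2] := nonzero_itv x; rewrite ger0_norm.
Qed.

Lemma enorm_coef_le x : B4 x -> enorm (coef (N := N) g x) <= #|{: K}|%:R * 2.
Proof. by move=> Bx; apply: enorm_le_card => k; exact: coef_le2. Qed.

(** ** Ellipticity *)

Lemma acoef_form x (xi : 'I_n -> R) :
  \sum_a \sum_b acoef g a b x * xi b * xi a =
  (1 - defect g nu (len x) * nonzero x) * esq xi +
  defect g nu (len x) * ((\sum_a x ord0 a * xi a) ^+ 2 / len x ^+ 2).
Proof.
set m := defect g nu (len x); set S := \sum_a _ * _.
transitivity (\sum_a ((1 - m * nonzero x) * xi a ^+ 2 +
    m * (x ord0 a * xi a * S / len x ^+ 2))).
  apply: eq_bigr => a _.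
  rewrite (eq_bigr (fun b => (1 - m * nonzero x) * xi a * ((a == b)%:R * xi b) +
     (m * (x ord0 a * xi a / len x ^+ 2)) * (x ord0 b * xi b))); last first.
    by move=> b _; rewrite /acoef /hat -/m; ring.
  by rewrite big_split /= -!mulr_sumr sum_delta -/S; ring.
rewrite big_split /= -!mulr_sumr -/(esq xi); congr (_ + m * _).
by rewrite -mulr_suml -mulr_suml -/S expr2.
Qed.

Lemma acoef_coercive x (xi : 'I_n -> R) : B4 x ->
  2^-1 * esq xi <= \sum_a \sum_b acoef g a b x * xi b * xi a.
Proof.
move=> Bx; have /andP[m0 m2] := defect_itv g0 g2 nu1 (ell_len_ge7 Bx).
rewrite acoef_form -[leLHS]addr0; apply: lerD.
  rewrite ler_wpM2r ?esq_ge0 //; have /andP[h1 h2] := nonzero_itv x.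
  have : defect g nu (len x) * nonzero x <= 2^-1 * 1 by apply: ler_pM.
  by lra.
by rewrite mulr_ge0 // divr_ge0 ?sqr_ge0.
Qed.

Lemma coef_form x (xi : 'I_N * 'I_n -> R) :
  \sum_i \sum_j \sum_a \sum_b coef g x (i, j, a, b) * xi (j, b) * xi (i, a) =
  \sum_i \sum_a \sum_b acoef g a b x * xi (i, b) * xi (i, a).
Proof.
apply: eq_bigr => i _; rewrite (bigD1 i) //= [X in _ + X]big1 ?addr0.
  by apply: eq_bigr => a _; apply: eq_bigr => b _; rewrite /coef /= eqxx mul1r.
move=> j ji; rewrite big1 // => a _; rewrite big1 // => b _.
by rewrite /coef /= eq_sym (negPf ji) !mul0r.
Qed.

Lemma coef_coercive x (xi : 'I_N * 'I_n -> R) : B4 x ->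
  2^-1 * enorm xi ^+ 2 <=
  \sum_i \sum_j \sum_a \sum_b coef g x (i, j, a, b) * xi (j, b) * xi (i, a).
Proof.
move=> Bx; rewrite coef_form sqr_enorm /esq.
rewrite (eq_bigr (fun p => xi (p.1, p.2) ^+ 2)); last by move=> [].
rewrite -(pair_bigA _ (fun i a => xi (i, a) ^+ 2)) /= mulr_sumr.
by apply: ler_sum => i _; exact: (acoef_coercive (fun a => xi (i, a)) Bx).
Qed.

Lemma integral_coef_coercive (f : 'rV[R]_n -> 'I_N * 'I_n -> R) : L2 B4 f ->
  (2^-1%:E * \int[mu]_(x in B4) (enorm (f x) ^+ 2)%:E <=
   \int[mu]_(x in B4) (\sum_i \sum_j \sum_a \sum_b
      coef g x (i, j, a, b) * f x (j, b) * f x (i, a))%:E)%E.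
Proof.
move=> f2; rewrite -ge0_integralZl //; first last.
- by move=> x _; rewrite lee_fin sqr_ge0.
- apply/measurable_EFinP; apply: measurable_funX; apply: measurable_enorm => k.
  by have [] := f2 k.
- exact: measurable_eball.
apply: le_integral_nomeas => x Bx; rewrite -EFinM lee_fin.
  by rewrite mulr_ge0 // sqr_ge0.
exact: coef_coercive.
Qed.

(** ** Modulus of continuity *)

Lemma coef_osc y z t k : 0 < t -> t <= 4 -> len y <= 4 -> len z <= 4 ->
  len (y - z) <= 2 * t ->
  `|coef (N := N) g y k - coef g z k| <= n.+1%:R * (10 * defect g nu t).
Proof.
move=> t0 t4 y4 z4 yz; have sd := submodulus_defect g0 g2 nu1.
have T a b := tensor_osc sd a b t0 t4 y4 z4 yz.
set D := 10 * _ in T *.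
have D0 : 0 <= D by apply: le_trans (T k.1.2 k.2); exact: normr_ge0.
rewrite /coef -mulrBr normrM -[leRHS]mul1r; apply: ler_pM => //.
  by case: eqP; rewrite ?normr1 ?normr0.
rewrite /acoef -!sum_hat; set m := defect g nu in T *.
have -> : (k.1.2 == k.2)%:R - m (len y) * ((k.1.2 == k.2)%:R * (\sum_a hat a a y) - hat k.1.2 k.2 y) -
   ((k.1.2 == k.2)%:R - m (len z) * ((k.1.2 == k.2)%:R * (\sum_a hat a a z) - hat k.1.2 k.2 z)) =
   (m (len y) * hat k.1.2 k.2 y - m (len z) * hat k.1.2 k.2 z) -
   (k.1.2 == k.2)%:R * (m (len y) * (\sum_a hat a a y) - m (len z) * (\sum_a hat a a z)) by ring.
apply: (le_trans (ler_normB _ _)).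
have -> : n.+1%:R * D = D + n%:R * D by rewrite -natr1; ring.
apply: lerD; first exact: T.
rewrite normrM -[leRHS]mul1r; apply: ler_pM => //.
  by case: eqP; rewrite ?normr1 ?normr0.
rewrite !mulr_sumr -sumrB; apply: (le_trans (ler_norm_sum _ _ _)).
rewrite mulr_natl -[n in leRHS]card_ord -sumr_const; apply: ler_sum => a _.
exact: T.
Qed.

Lemma defect_small (e : R) : 0 < e -> exists2 t, 0 < t <= 4 & defect g nu t < e.
Proof.
move=> e0; have [d d0 dP] := @ell_large R (2 / e).
pose t := Num.min (d / 2) 4; have t0 : 0 < t by rewrite lt_min divr_gt0 //=.
have t4 : t <= 4 by rewrite ge_min lexx orbT.
exists t; first by rewrite t0.
have /andP[_ h] := defect_itv_ell g0 g2 nu1 (ell_ge7 t0 t4).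
apply: (le_lt_trans h).
have td : t < d.
  apply: (@le_lt_trans _ _ (d / 2)); first by rewrite ge_min lexx.
  by rewrite ltr_pdivrMr // ltr_pMr // ltr1n.
have h2 := dP t t0 td; rewrite ltr_pdivrMr // in h2.
by rewrite ltr_pdivrMr ?ell_gt0 //; move: g2 => ?; lra.
Qed.

Lemma closure_B4 : closure B4 `<=` [set y | len y <= 4].
Proof.
have : closed [set y : 'rV[R]_n | len y <= 4].
  rewrite (_ : mkset _ = @len R n @^-1` [set r | r <= 4]) //.
  by apply: closed_comp => [y _|]; [exact: continuous_len|exact: closed_le].
move=> /closure_id ->; apply: closure_subset => y.
by rewrite eball0E /=; exact: ltW.
Qed.

Lemma continuous_coef k : {within closure B4, continuous (fun x => coef (N := N) g x k)}.
Proof.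
apply/subspace_continuousP => x /closure_B4 /= x4.
apply/cvgrPdist_lt => e e0.
have [|t /andP[t0 t4] te] := @defect_small (e / (n.+1%:R * 10)).
  by rewrite divr_gt0 // mulr_gt0.
have near_t : \forall y \near x, len (y - x) < t.
  apply/nbhs_ballP; exists (t / n.+1%:R); first by rewrite /= divr_gt0.
  move=> y [_ xy]; rewrite lenC.
  apply: (@le_lt_trans _ _ (n%:R * (t / n.+1%:R))).
    have := @enorm_le_card R _ ((x - y) ord0) (t / n.+1%:R); rewrite card_ord; apply => i.
    by have := ltW (xy ord0 i); rewrite !mxE.
  by rewrite mulrA ltr_pdivrMr // mulrC ltr_pM2l // ltr_nat.
rewrite near_withinE; apply: filterS near_t => y yt /closure_B4 /= y4.
apply: le_lt_trans (coef_osc k t0 t4 x4 y4 _) _.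
  by rewrite lenC; lra.
by move: te; rewrite ltr_pdivlMr ?mulr_gt0 //; lra.
Qed.

(** ** The oscillation modulus *)

Lemma omega2_ge0 t : (0 <= omega2 (coef (N := N) (n := n) g) t)%E.
Proof.
apply: le_ereal_sup_tmp.
exists (mean_osc 2 (eball (0 : 'rV[R]_n) t) (coef (N := N) g) `^ 2^-1)%E; last exact: poweR_ge0.
by exists 0 => //; rewrite eball0E /= len0.
Qed.

(** The mean square oscillation at scale t is bounded by the uniform one. *)
Lemma omega2_coef_le t : 0 < t -> t <= 2 ->
  (omega2 (coef (N := N) (n := n) g) t <=
   (#|{: K}|%:R * n.+1%:R * 30 * g / ell t)%:E)%E.
Proof.
move=> t0 t2; have t4 : t <= 4 by lra.
apply: ge_ereal_sup => _ [x x2 <-]; rewrite eball0E /= in x2.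
have sub y : eball x t y -> len y <= 4.
  rewrite eballE /= => yx; have := len_dist y x; lra.
have [fin vol] := le_measure_eball n0 t0 (measurable_eball x t) (@subset_refl _ _) (@subset_refl _ (eball x t)).
have v0 : 0 < fine (mu (eball x t)).
  by apply: lt_le_trans vol; rewrite exprn_gt0 // divr_gt0 // ltr0n.
pose d := n.+1%:R * (10 * defect g nu t).
have /andP[m0 m1] := defect_itv_ell g0 g2 nu1 (ell_ge7 t0 t4).
have d0 : 0 <= #|{: K}|%:R * d by rewrite !mulr_ge0.
have osc := @mean_osc_le_sup R n _ (measurable_eball x t) fin v0 _ (coef (N := N) g) 2 d
  (fun k => measurable_funTS (measurable_coef g k)).
apply: (@le_trans _ _ (((#|{: K}|%:R * d) ^+ 2)%:E `^ 2^-1)%E).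
  apply: gt0_ler_poweR.
  - by rewrite invr_ge0.
  - rewrite in_itv /= leey andbT mule_ge0 //.
      by rewrite lee_fin invr_ge0 ltW.
    by apply: integral_ge0 => y _; rewrite lee_fin exprn_ge0 // enorm_ge0.
  - by rewrite in_itv /= leey andbT lee_fin sqr_ge0.
  - apply: osc => k y z By Bz; apply: coef_osc => //; [exact: sub|exact: sub|].
    have -> : y - z = (y - x) + (x - z) by rewrite addrA subrK.
    apply: (le_trans (len_triangle _ _)); move: By Bz; rewrite !eballE /= => By Bz.
    by rewrite (lenC x); lra.
rewrite poweR_EFin lee_fin powR12_sqrt ?sqr_ge0 // sqrtr_sqr ger0_norm //.
apply: (@le_trans _ _ (#|{: K}|%:R * (n.+1%:R * (10 * (3 * g / ell t))))).
  by rewrite ler_wpM2l // ler_wpM2l // ler_wpM2l.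
by rewrite le_eqVlt; apply/orP; left; apply/eqP; ring.
Qed.

End coefficients.

(** * The gradient: vanishing mean oscillation and unboundedness *)

Section gradient.
Context {R : realType}.
Variables (n N : nat) (o : 'I_n) (g : R).
Hypotheses (n2 : (2 <= n)%N) (g0 : 0 < g) (g2 : g <= 2^-1).
Local Notation mu := (@lebesgue_rV R n).
Local Notation B4 := (eball (0 : 'rV[R]_n) 4).
Local Notation D := (dsol (N := N) o g).
Local Notation K := ('I_N * 'I_n)%type.
Implicit Types x y z : 'rV[R]_n.
Let n0 : (0 < n)%N. Proof. exact: ltnW. Qed.
Let nR : 0 < n%:R :> R. Proof. by rewrite ltr0n. Qed.
Let mB4 : measurable B4. Proof. exact: measurable_eball. Qed.

(** B4 is convex: a ball of radius s / 2 fits in the intersection, its centre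
    being the point x moved towards the origin. *)
Lemma ball_cap x (s : R) : B4 x -> 0 < s -> s <= 8 ->
  exists z, eball z (s / 2) `<=` eball x s `&` B4.
Proof.
rewrite eball0E /= => x4 s0 s8; exists ((1 - s / 8) *: x) => y.
rewrite eballE /= => yz.
have xlen := len_ge0 x.
have zx : len ((1 - s / 8) *: x - x) = s / 8 * len x.
  have -> : (1 - s / 8) *: x - x = (- (s / 8)) *: x.
    by rewrite scalerBl scale1r addrAC subrr add0r scaleNr.
  by rewrite lenZ normrN ger0_norm // divr_ge0 // ltW.
have zl : len ((1 - s / 8) *: x) = (1 - s / 8) * len x.
  by rewrite lenZ ger0_norm // subr_ge0 ler_pdivrMr // mul1r.
split.
  change (len (y - x) < s).
  have -> : y - x = (y - (1 - s / 8) *: x) + ((1 - s / 8) *: x - x).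
    by rewrite addrA subrK.
  apply: le_lt_trans (len_triangle _ _) _; rewrite zx.
  have : s / 8 * len x <= s / 8 * 4 by rewrite ler_wpM2l ?ltW // divr_gt0.
  lra.
apply: le_lt_trans (len_dist y ((1 - s / 8) *: x)) _; rewrite zl.
have : (1 - s / 8) * len x <= (1 - s / 8) * 4.
  by rewrite ler_wpM2l ?(ltW x4) // subr_ge0 ler_pdivrMr // mul1r.
lra.
Qed.

Lemma measurable_cap x s : measurable (eball x s `&` B4).
Proof. by apply: measurableI => //; exact: measurable_eball. Qed.

Lemma cap_volume x (s : R) : B4 x -> 0 < s -> s <= 8 ->
  (mu (eball x s `&` B4) < +oo)%E /\
  (s / 2 / n%:R) ^+ n <= fine (mu (eball x s `&` B4)).
Proof.
move=> Bx s0 s8; have [z zs] := ball_cap Bx s0 s8.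
apply: (@le_measure_eball _ _ 0 z (s / 2) 4) => //; first by rewrite divr_gt0.
exact: measurable_cap.
Qed.

Lemma dsolE y q :
  D y q = rprof g (len y) * (o == q.2)%:R - g * (rslope g (len y) * hat o q.2 y).
Proof. by rewrite /dsol /dradial /dprof /rslope /rprof !mulrA. Qed.

(** Far from the origin, compared with the radius, the oscillation is uniformly
    small. *)
Lemma mean_osc_far x s : B4 x -> 0 < s -> s <= 2^-1 -> 4 * s <= len x ->
  (mean_osc 1 (eball x s `&` B4) D <= (#|{: K}|%:R * (14 * rslope g s))%:E)%E.
Proof.
move=> Bx s0 s1 sx; have s8 : s <= 8 by lra.
have [fin vol] := cap_volume Bx s0 s8.
have v0 : 0 < fine (mu (eball x s `&` B4)).
  by apply: lt_le_trans vol; rewrite exprn_gt0 // !divr_gt0.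
rewrite -[X in (_ <= X%:E)%E]expr1.
apply: mean_osc_le_sup => //; first exact: measurable_cap.
  by move=> q; apply: measurable_funTS; exact: measurable_dsol.
move=> q y z [yx By] [zx Bz].
have s4 : s <= 4 by lra.
move: By Bz yx zx; rewrite !eballE /= !subr0 => /ltW y4 /ltW z4 yx zx.
have yl : 2 * s <= len y.
  by have := len_dist x y; rewrite (lenC x); move=> ?; lra.
have zl : 2 * s <= len z.
  by have := len_dist x z; rewrite (lenC x); move=> ?; lra.
have yz : len (y - z) <= 2 * s.
  have -> : y - z = (y - x) + (x - z) by rewrite addrA subrK.
  by apply: (le_trans (len_triangle _ _)); rewrite (lenC x); lra.
have h1 := rprof_osc_far g0 g2 s0 y4 z4 yl zl yz.
have h2 := tensor_osc (submodulus_rslope g0 g2) o q.2 s0 s4 y4 z4 yz.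
have P0 : 0 <= rslope g s := submodulus_ge0 (submodulus_rslope g0 g2) s0 s4.
have -> : D y q - D z q = (rprof g (len y) - rprof g (len z)) * (o == q.2)%:R -
    g * (rslope g (len y) * hat o q.2 y - rslope g (len z) * hat o q.2 z).
  rewrite !dsolE; move: (rprof g _) (rprof g _) (rslope g _ * _) (rslope g _ * _) => a b c d; ring.
apply: (le_trans (ler_normB _ _)).
have -> : 14 * rslope g s = 4 * rslope g s + 10 * rslope g s by ring.
apply: lerD; rewrite normrM.
  by rewrite -[leRHS]mulr1 ler_pM //; case: eqP; rewrite ?normr1 ?normr0.
rewrite -[leRHS]mul1r ler_pM // gtr0_norm //.
by move: g2 => ?; lra.
Qed.

(** Near the origin the gradient differs from the constant rprof (5 s) delta by at
    most rslope (5 s) times a logarithm, whose mean over the ball is bounded. *)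
Lemma mean_osc_near x s : B4 x -> 0 < s -> s <= 2^-1 -> len x <= 4 * s ->
  (mean_osc 1 (eball x s `&` B4) D <=
   (2 * #|{: K}|%:R * (rslope g (5 * s) * (1 + 2 * (20 * n%:R) ^+ n)))%:E)%E.
Proof.
move=> Bx s0 s1 sx; have s8 : s <= 8 by lra.
have [fin vol] := cap_volume Bx s0 s8.
set E := eball x s `&` B4 in fin vol *.
have v0 : 0 < fine (mu E).
  by apply: lt_le_trans vol; rewrite exprn_gt0 // !divr_gt0.
have mE : measurable E by exact: measurable_cap.
have EB : E `<=` B4 by move=> y [].
have E5 : E `<=` eball 0 (5 * s).
  move=> y [+ _]; rewrite eball0E eballE /= => yx.
  by apply: le_lt_trans (len_dist y x) _; lra.
have r0 : 0 < 5 * s by rewrite mulr_gt0.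
have r4 : 5 * s <= 4 by lra.
have hP := submodulus_rslope g0 g2.
have P0 := submodulus_ge0 hP r0 r4.
apply: (@mean_osc1_le R n E mE fin v0 _ D (fun q => rprof g (5 * s) * (o == q.2)%:R)).
  by move=> q; apply: (integrableS mB4 mE EB); exact: integrable_dsol.
move=> q.
apply: (@le_trans _ _ (\int[mu]_(y in E)
   ((rslope g (5 * s))%:E * (1 + `|ln (5 * s / len y)|%:E)))%E).
  apply: ae_ge0_le_integral => //.
  - apply/measurable_EFinP; apply: measurableT_comp => //.
    apply: measurable_funB => //; apply: measurable_funTS; exact: measurable_dsol.
  - by move=> y _; rewrite mule_ge0 // ?lee_fin // addr_ge0.
  - apply/measurable_EFinP; apply: measurable_funM => //; apply: measurable_funD => //.
    by apply: measurableT_comp => //; exact: measurable_ln_len.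
  - apply: (ae_off_origin n2) => y y0 Ey.
    have y5 := E5 _ Ey; rewrite eball0E /= in y5.
    rewrite -EFinD -EFinM lee_fin.
    have -> : D y q - rprof g (5 * s) * (o == q.2)%:R =
      (rprof g (len y) - rprof g (5 * s)) * (o == q.2)%:R - g * (rslope g (len y) * hat o q.2 y).
      by rewrite dsolE addrAC mulrBl.
    have [a b _] := hP _ _ y0 (ltW y5) r4.
    have hG := rprof_sub g0 g2 y0 (ltW y5) r4.
    rewrite mulrDr mulr1 [leRHS]addrC; apply: (le_trans (ler_normB _ _)); apply: lerD.
      apply: (@le_trans _ _ (rslope g (5 * s) * ln (5 * s / len y))).
        rewrite normrM -[leRHS]mulr1; apply: ler_pM => //.
        by case: eqP; rewrite ?normr1 ?normr0.
      by rewrite ler_wpM2l // ler_norm.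
    rewrite normrM -[leRHS]mul1r; apply: ler_pM => //.
      by rewrite gtr0_norm //; move: g2 => ?; lra.
    rewrite normrM -[leRHS]mulr1; apply: ler_pM => //; last exact: hat_le1.
    by rewrite ger0_norm.
have mln : measurable_fun E (fun y => `|ln (5 * s / len y)|%:E).
  apply/measurable_EFinP; apply: measurableT_comp => //; exact: measurable_ln_len.
rewrite ge0_integralZl //; first last.
- by move=> y _; rewrite adde_ge0 // lee_fin.
- by apply: emeasurable_funD.
rewrite -[leRHS]EFinM -mulrA EFinM; apply: lee_wpmul2l; first by rewrite lee_fin.
rewrite ge0_integralD //.
have -> : ((1 + 2 * (20 * n%:R) ^+ n) * fine (mu E))%:E =
  (mu E + (2 * (20 * n%:R) ^+ n * fine (mu E))%:E)%E.
  by rewrite mulrDl mul1r EFinD fineK // ge0_fin_numE.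
apply: leeD.
  by rewrite integral_cst // mul1e.
apply: le_trans (integral_ln_len n0 r0 mE E5) _; rewrite lee_fin -mulrA ler_wpM2l //.
have -> : 2 * (5 * s) = (20 * n%:R) * (s / 2 / n%:R) by field; rewrite gt_eqF.
by rewrite exprMn ler_wpM2l // exprn_ge0 // mulr_ge0.
Qed.

Lemma mean_osc_small (e : R) : 0 < e ->
  exists2 d, 0 < d <= 2^-1 & forall x s, B4 x -> 0 < s -> s < d ->
    (mean_osc 1 (eball x s `&` B4) D <= e%:E)%E.
Proof.
move=> e0.
pose A1 : R := #|{: K}|%:R * 14.
pose A2 : R := 2 * #|{: K}|%:R * (1 + 2 * (20 * n%:R) ^+ n).
have A1_0 : 0 <= A1 by rewrite mulr_ge0.
have A2_0 : 0 <= A2.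
  by rewrite mulr_ge0 ?mulr_ge0 // addr_ge0 // mulr_ge0 // exprn_ge0 // mulr_ge0.
have A0 : 0 < A1 + A2 + 1 by rewrite ltr_wpDl // addr_ge0.
have [d d0 dP] := rslope_small g2 (divr_gt0 e0 A0).
exists (Num.min (d / 5) 2^-1).
  apply/andP; split; first by rewrite lt_min divr_gt0 //= invr_gt0.
  by rewrite ge_min lexx orbT.
move=> x s Bx s0; rewrite lt_min => /andP[sd s1].
have sd5 : 5 * s < d by move: sd; rewrite ltr_pdivlMr // mulrC.
have hP := submodulus_rslope g0 g2.
have key r : 0 < r -> r < d -> r <= 4 -> 0 <= rslope g r /\ (A1 + A2 + 1) * rslope g r <= e.
  move=> r0 rd r4; split; first exact: submodulus_ge0 hP r0 r4.
  by have := dP r r0 rd r4; rewrite ltr_pdivlMr // mulrC => /ltW.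
have [sx|sx] := leP (4 * s) (len x).
  apply: le_trans (mean_osc_far Bx s0 (ltW s1) sx) _; rewrite lee_fin.
  have [|||P0 Pe] := key s => //; [lra|lra|].
  rewrite mulrA -/A1; apply: le_trans Pe; rewrite ler_wpM2r //; lra.
apply: le_trans (mean_osc_near Bx s0 (ltW s1) (ltW sx)) _; rewrite lee_fin.
have [|||P0 Pe] := key (5 * s) => //; [lra|lra|].
rewrite [rslope _ _ * _]mulrC mulrA -/A2; apply: le_trans Pe; rewrite ler_wpM2r //; lra.
Qed.

(** For radii bounded below, the mean oscillation is controlled by the L^1
    norm. *)
Lemma mean_osc_bounded : exists M : R, 0 <= M /\ forall x s, B4 x -> 0 < s ->
  (mean_osc 1 (eball x s `&` B4) D <= M%:E)%E.
Proof.
have [d /andP[d0 d1] dP] := mean_osc_small (ltr01 : 0 < 1 :> R).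
pose I1 : R := \sum_q fine (\int[mu]_(y in B4) `|D y q|%:E)%E.
have intf q : (\int[mu]_(y in B4) `|D y q|%:E)%E \is a fin_num.
  have iq := integrable_abse (integrable_dsol (N := N) o n2 g0 g2 q).
  exact: (integrable_fin_num mB4 iq).
have I0 q : 0 <= fine (\int[mu]_(y in B4) `|D y q|%:E)%E.
  by apply: fine_ge0; apply: integral_ge0 => y _; rewrite lee_fin.
have I1q q : (\int[mu]_(y in B4) `|D y q|%:E <= I1%:E)%E.
  rewrite -(fineK (intf q)) lee_fin /I1 (bigD1 q) //= lerDl.
  by apply: sumr_ge0 => q' _; exact: I0.
have I10 : 0 <= I1 by apply: sumr_ge0 => q _; exact: I0.
pose v : R := (d / 2 / n%:R) ^+ n.
have v0 : 0 < v by rewrite exprn_gt0 // !divr_gt0.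
pose M := 2 * #|{: K}|%:R * (I1 / v).
have M0 : 0 <= M by rewrite !mulr_ge0 // invr_ge0 ltW.
exists (1 + M); split; first by rewrite addr_ge0.
move=> x s Bx s0; have [sd|ds] := ltP s d.
  by apply: le_trans (dP x s Bx s0 sd) _; rewrite lee_fin lerDl.
have d8 : d <= 8 by lra.
have [z zE] := ball_cap Bx d0 d8.
have zE' : eball z (d / 2) `<=` eball x s `&` B4.
  move=> y /zE [yx By]; split => //.
  by move: yx; rewrite !eballE /=; move=> /lt_le_trans; apply.
have d2 : 0 < d / 2 by rewrite divr_gt0.
have [vfin vol] := @le_measure_eball _ _ 0 z (d / 2) 4 _ n0 d2 (measurable_cap x s) zE' (@subIsetr _ _ _).
set E := eball x s `&` B4 in vfin vol *.
have mE : measurable E by exact: measurable_cap.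
have vE : 0 < fine (mu E) by exact: lt_le_trans vol.
apply: (@le_trans _ _ M%:E); last by rewrite lee_fin lerDr.
apply: (@mean_osc1_le R n E mE vfin vE _ D (fun q => 0)).
  by move=> q; apply: (integrableS mB4 mE (@subIsetr _ _ _)); exact: integrable_dsol.
move=> q; under eq_integral do rewrite subr0.
apply: (@le_trans _ _ I1%:E).
  apply: le_trans (I1q q); apply: ge0_subset_integral => //.
    by apply/measurable_EFinP; apply: measurableT_comp => //;
       apply: measurable_funTS; exact: measurable_dsol.
  exact: subIsetr.
by rewrite lee_fin mulrAC ler_pdivlMr // ler_wpM2l.
Qed.

Lemma vmo_modulus_ge0 (r : R) : 0 < r -> (0 <= vmo_modulus B4 D r)%E.
Proof.
move=> r0; apply: le_ereal_sup_tmp.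
exists (mean_osc 1 (eball 0 r `&` B4) D).
  by exists 0, r; split => //; [rewrite eball0E /= len0|rewrite r0 lexx].
rewrite /mean_osc mule_ge0 //.
  by rewrite lee_fin invr_ge0; exact: fine_ge0.
by apply: integral_ge0 => y _; rewrite lee_fin exprn_ge0 // enorm_ge0.
Qed.

Lemma VMO_dsol : VMO B4 D.
Proof.
have [M [M0 MP]] := mean_osc_bounded.
split.
- by move=> q; exact: integrable_dsol.
- exists M => r; apply: ge_ereal_sup => _ [x [s [Bx /andP[s0 _] ->]]].
  exact: MP.
- have fin r : 0 < r -> vmo_modulus B4 D r \is a fin_num.
    move=> r0; rewrite ge0_fin_numE ?vmo_modulus_ge0 //.
    apply: (@le_lt_trans _ _ M%:E); last exact: ltry.
    by apply: ge_ereal_sup => _ [x [s [Bx /andP[s0 _] ->]]]; exact: MP.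
  apply/fine_cvgP; split.
    by near=> r; apply: fin; near: r; exact: nbhs_right_gt.
  apply/cvgrPdist_le => e e0.
  have [d /andP[d0 d1] dP] := mean_osc_small e0.
  near=> r.
  have r0 : 0 < r by near: r; exact: nbhs_right_gt.
  have rd : r < d by near: r; exact: nbhs_right_lt.
  rewrite /= sub0r normrN ger0_norm; last by apply: fine_ge0; exact: vmo_modulus_ge0.
  rewrite -lee_fin fineK ?fin //.
  apply: ge_ereal_sup => _ [x [s [Bx /andP[s0 sr] ->]]].
  by apply: dP => //; exact: le_lt_trans rd.
Unshelve. all: by end_near. Qed.

(** Near the origin the component along o of the gradient is at least rprof - 1. *)
Lemma dsol_unbounded (i : 'I_N) : ~ Linfty_loc (eball (0 : 'rV[R]_n) 2) D.
Proof.
move=> [_ h].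
pose C := cube (0 : 'rV[R]_n) n%:R^-1.
have cC : compact C.
  rewrite /C cubeE; apply: (@rV_compact _ _ (fun i => `[_, _]%classic)) => j.
  exact: segment_compact.
have CB : C `<=` eball 0 2.
  by apply: cube_sub_eball; rewrite divff ?gt_eqF // ltr1n.
have [M [Z [mZ Z0 ZP]]] := h C cC CB.
have [d d0 dP] := rprof_large g0 (M + 1).
pose r := Num.min d n%:R^-1.
have r0 : 0 < r by rewrite lt_min d0 invr_gt0.
have r1 : r <= 1.
  by rewrite ge_min; apply/orP; right; rewrite invf_le1 // ler1n.
have sub : eball 0 r `<=` Z `|` [set 0].
  move=> y; rewrite eball0E /= => yr.
  have [y0|y0] := pselect (y = 0); [by right|left].
  have yp : 0 < len y by apply: neq0_len_gt0; exact/eqP.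
  apply: ZP => /= hy.
  have Cy : C y.
    move=> j; rewrite mxE subr0; apply: (le_trans (le_coord_len y j)).
    by apply: (le_trans (ltW yr)); rewrite ge_min lexx orbT.
  have y4 : len y <= 4 by lra.
  have yd : len y < d by apply: (lt_le_trans yr); rewrite ge_min lexx.
  have hG := dP _ yp yd y4.
  have P1 := rslope_le1 g2 yp y4.
  have P0 := submodulus_ge0 (submodulus_rslope g0 g2) yp y4.
  have := hy Cy; apply/negP; rewrite -ltNge.
  apply: lt_le_trans (le_abs_enorm (D y) (i, o)).
  apply: lt_le_trans (ler_norm _).
  have -> : D y (i, o) = rprof g (len y) - g * (rslope g (len y) * hat o o y).
    by rewrite dsolE /= eqxx mulr1.
  have : g * (rslope g (len y) * hat o o y) <= 1.
    apply: (le_trans (ler_norm _)); rewrite normrM -[leRHS]mulr1.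
    apply: ler_pM => //; first by rewrite gtr0_norm //; move: g2 => ?; lra.
    rewrite normrM -[leRHS]mulr1; apply: ler_pM => //; last exact: hat_le1.
    by rewrite ger0_norm.
  lra.
have [_ vol] := le_measure_eball n0 r0 (measurable_eball 0 r)
  (@subset_refl _ _) (@subset_refl _ (eball (0 : 'rV[R]_n) r)).
have : (mu (eball 0 r) <= 0)%E.
  apply: (@le_trans _ _ (mu (Z `|` [set 0]))).
    apply: le_measure; rewrite ?inE //; first exact: measurable_eball.
    by apply: measurableU => //; exact: measurable_origin.
  have Z00 : (mu Z + mu [set 0%R] <= 0)%E by rewrite Z0 origin_null // adde0.
  apply: le_trans Z00; apply: measureU2 => //; exact: measurable_origin.
rewrite measure_le0 => /eqP E0; move: vol; rewrite E0 /=.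
by rewrite leNgt exprn_gt0 // divr_gt0.
Qed.

End gradient.

Theorem proposition1p5 (R : realType) (n N : nat) (hn : (2 <= n)%N)
    (hN : (1 <= N)%N) (Cstar : nat -> nat -> R -> R -> R)
    (hCstar : forall Lam lam : R, 0 < Lam -> 0 < lam ->
       0 < Cstar n N Lam lam) :
  let B4 : set 'rV[R]_n := eball 0 4 in
  let B2 : set 'rV[R]_n := eball 0 2 in
  exists (lam Lam : R) (A : 'rV[R]_n -> 'I_N * 'I_N * 'I_n * 'I_n -> R)
         (u : 'rV[R]_n -> 'I_N -> R) (Du : 'rV[R]_n -> 'I_N * 'I_n -> R),
    (0 < lam /\ 0 < Lam) /\
    (forall k, {within closure B4, continuous (A^~ k)}) /\
    {ae lebesgue_rV n, forall x, B4 x -> enorm (A x) <= Lam} /\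
    (forall (phi : 'rV[R]_n -> 'I_N -> R) (Dphi : 'rV[R]_n -> 'I_N * 'I_n -> R),
       sobolev_H10 B4 phi Dphi ->
       (lam%:E * \int[lebesgue_rV n]_(x in B4) (enorm (Dphi x) ^+ 2)%:E <=
        \int[lebesgue_rV n]_(x in B4)
          (\sum_(i < N) \sum_(j < N) \sum_(a < n) \sum_(b < n)
             A x (i, j, a, b) * Dphi x (j, b) * Dphi x (i, a))%:E)%E) /\
    limf_esup (fun r : R =>
      (r%:E * \int[lebesgue_measure]_(t in `[r, 2%R])
         (omega2 A t * ((t ^+ 2)^-1)%:E *
          expeR ((Cstar n N Lam lam)%:E *
            \int[lebesgue_measure]_(s in `[t, 2%R])
              (omega2 A s * (s^-1)%:E))))%E) 0^'+ = 0%E /\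
    sobolev_H1 B4 u Du /\
    weak_solution B4 A Du /\
    VMO B4 Du /\
    ~ Linfty_loc B2 Du.

Proof.
move=> B4 B2.
have n0 : (0 < n)%N by exact: ltnW.
pose o : 'I_n := Ordinal n0; pose i0 : 'I_N := Ordinal hN.
pose k : R := #|{: 'I_N * 'I_N * 'I_n * 'I_n}|%:R.
have k0 : 0 < k.
  rewrite ltr0n; apply/card_gt0P; exists (i0, i0, o, o); exact: isT.
pose lam : R := 2^-1; pose Lam : R := k * 2.
have lam0 : 0 < lam by rewrite invr_gt0.
have Lam0 : 0 < Lam by rewrite mulr_gt0.
pose C := Cstar n N Lam lam; have C0 : 0 < C by exact: hCstar.
pose M : R := k * n.+1%:R * 30.
have M0 : 0 < M by rewrite !mulr_gt0.
(* The exponent g is chosen after the constant C, whose arguments lam and Lam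
   do not depend on it. *)
pose g : R := Num.min 2^-1 (2 * C * M)^-1.
have g0 : 0 < g.
  by rewrite lt_min !invr_gt0 ltr0n /= mulr_gt0 // mulr_gt0.
have g2 : g <= 2^-1 by rewrite ge_min lexx.
have Cg : C * (M * g) <= 2^-1.
  rewrite mulrA; apply: (@le_trans _ _ (C * M * (2 * C * M)^-1)).
    have CM0 : 0 <= C * M by rewrite ltW // mulr_gt0.
    by apply: ler_wpM2l => //; rewrite ge_min lexx orbT.
  by rewrite le_eqVlt; apply/orP; left; apply/eqP; field; rewrite !gt_eqF.
exists lam, Lam, (coef g), (sol o g), (dsol o g).
split; first by [].
split; first by move=> q; exact: continuous_coef.
split.
  by apply: aeW => x Bx; exact: enorm_coef_le.
split.
  move=> f Df [[_ Df2 _] _].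
  exact: integral_coef_coercive.
split.
  apply: (@limf_esup_dini _ _ C (M * g)) => //.
  - exact: ltW.
  - by rewrite mulr_ge0 // ltW.
  - by move=> t; exact: omega2_ge0.
  - by move=> t t0 t2; exact: omega2_coef_le.
split; first exact: sobolev_sol.
split; first exact: weak_solution_sol.
split; first exact: VMO_dsol.
exact: dsol_unbounded.
Qed.
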